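(* Let $F$ be a probability distribution on $[0,\infty)$ with finite mean and finite variance, having a density $f$. Assume that $f(t)\to f(0)$ as $t\to 0+$, where $f(0)\in(0,\infty)$. Let $T_n^{NN}$ be the length of the nearest neighbor tour on $n$ cities in the mean field traveling salesman problem with intercity distance distribution $F$. Then, as $n\to\infty$, $$\frac{T_n^{NN}}{\log n}\longrightarrow \frac{1}{f(0)}\quad\text{in probability},$$ and $$\mathbb{E}[T_n^{NN}]\sim \frac{1}{f(0)}\log n .$$ Moreover, the convergence $\frac{T_n^{NN}}{\log n}\to\frac{1}{f(0)}$ also holds in $\mathcal{L}_2$.
   Context: Mean field traveling salesman problem: there are $n$ cities $1,2,\dots,n$, and the intercity distances $L_{ij}=L_{ji}$, $1\le i<j\le n$, are i.i.d. random variables with distribution $F$ (no triangle inequality is required). Nearest neighbor (NN) tour: start at $v_1=1$; given $v_1,\dots,v_i$ with $i<n$, let $v_{i+1}$ be the city $u\notin\{v_1,\dots,v_i\}$ minimizing $L_{v_i u}$ (ties broken arbitrarily; they have probability zero when $F$ has a density); after all cities are visited, return to city $1$, i.e. $v_{n+1}=1$. The length of the NN tour is $T_n^{NN}=\sum_{i=1}^{n} L_{v_i v_{i+1}}$. The notation $a_n\sim b_n$ means $\lim_{n\to\infty} a_n/b_n=1$. *)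

(* Defs.v *)
From mathcomp Require Import all_boot all_order all_algebra finmap.
From mathcomp Require Import all_classical all_reals all_analysis.

Set Implicit Arguments.
Unset Strict Implicit.
Unset Printing Implicit Defensive.

Import Order.TTheory GRing.Theory Num.Theory.
Import numFieldNormedType.Exports.

Local Open Scope classical_set_scope.
Local Open Scope ring_scope.

Definition supported_nneg (R : realType)
    (F : probability (measurableTypeR R) R) : Prop :=
  F [set x : R | x < 0] = 0%E.

(* The expectation is an integral in [\bar R], equal to [+oo] when a nonnegative
   function is not integrable; the variance is centered at [fine] of the mean,
   so it is meaningful only together with the finiteness of the mean. *)
Definition finite_mean (R : realType)
    (F : probability (measurableTypeR R) R) : Prop :=
  ('E_F [(fun x : R => x)] \is a fin_num)%E.

Definition finite_variance (R : realType)
    (F : probability (measurableTypeR R) R) : Prop :=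
  ('V_F [(fun x : R => x)] \is a fin_num)%E.

Definition is_density (R : realType)
    (F : probability (measurableTypeR R) R) (f : R -> R) : Prop :=
  [/\ measurable_fun [set: R] f,
      (forall x : R, 0 <= f x) &
      (forall A : set R, measurable A ->
         F A = \int[lebesgue_measure]_(x in A) (f x)%:E)%E].

Definition mutually_independent (d d' : measure_display)
    (Omega : measurableType d) (E : measurableType d') (R : realType)
    (P : probability Omega R) (I : choiceType) (D : set I)
    (X : I -> {RV P >-> E}) : Prop :=
  forall (J : {fset I}) (B : I -> set E),
    (forall i : I, i \in J -> D i) ->
    (forall i : I, measurable (B i)) ->
    P (\bigcap_(i in [set i | i \in J]) (X i @^-1` B i))
      = (\prod_(i <- J) P (X i @^-1` B i))%E.

(* The diagonal entries [L i i] are unconstrained: a nearest neighbor tour on at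
   least two cities never uses them. *)
Definition iid_distances (d : measure_display) (Omega : measurableType d)
    (R : realType) (P : probability Omega R) (n : nat)
    (F : probability (measurableTypeR R) R)
    (L : 'I_n -> 'I_n -> {RV P >-> R}) : Prop :=
  [/\ (forall (i j : 'I_n) (w : Omega), L i j w = L j i w),
      (forall i j : 'I_n, (i < j)%N ->
         forall A : set R, measurable A -> distribution P (L i j) A = F A) &
      mutually_independent
        [set ij : 'I_n * 'I_n | (ij.1 < ij.2)%N] (fun ij => L ij.1 ij.2)].

(* Tours are sequences [v 1, ..., v n, v n.+1] indexed from 1; the value [v 0] and
   those beyond [n.+1] are irrelevant. *)
Definition unvisited (n : nat) (v : nat -> 'I_n) (i : nat) (u : 'I_n) : Prop :=
  forall j : nat, (1 <= j <= i)%N -> u <> v j.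

(* Ties are broken arbitrarily: [v i.+1] is some minimizer. *)
Definition is_NN_tour (R : realType) (n : nat) (dist : 'I_n -> 'I_n -> R)
    (start : 'I_n) (v : nat -> 'I_n) : Prop :=
  [/\ v 1%N = start,
      (forall i : nat, (1 <= i < n)%N ->
         unvisited v i (v i.+1) /\
         (forall u : 'I_n, unvisited v i u ->
            dist (v i) (v i.+1) <= dist (v i) u)) &
      v n.+1 = start].

Definition tour_length (R : realType) (n : nat) (dist : 'I_n -> 'I_n -> R)
    (v : nat -> 'I_n) : R :=
  \sum_(1 <= i < n.+1) dist (v i) (v i.+1).

(* The random variables may live on different probability spaces, as the limit
   is a constant. *)
Definition cvg_in_probability (R : realType) (d : nat -> measure_display)
    (Omega : forall n : nat, measurableType (d n))
    (P : forall n : nat, probability (Omega n) R)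
    (X : forall n : nat, Omega n -> R) (c : R) : Prop :=
  forall eps : R, 0 < eps ->
    P n [set w | eps < `|X n w - c|] @[n --> \oo] --> 0%E.

Definition cvg_in_Lp (R : realType) (p : \bar R) (d : nat -> measure_display)
    (Omega : forall n : nat, measurableType (d n))
    (P : forall n : nat, probability (Omega n) R)
    (X : forall n : nat, Omega n -> R) (c : R) : Prop :=
  (forall n : nat, X n \in Lfun (P n) p) /\
  ('N[P n]_p [(fun w => (X n w - c)%:E)] @[n --> \oo] --> 0)%E.

(* Main.v *)
(* Until the last return to city 1, the NN tour examines fresh edges only: when
   [k] cities are left, the next step is the minimum of [k] distances that are
   independent of everything seen so far. So the steps are independent and the
   one made with [k] cities left has tail [P(L > t) ^ k], hence mean
   [int_0^oo P(L > t) ^ k dt], which is equivalent to [1 / (f(0) k)] because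
   [P(L > t) = 1 - f(0) t + o(t)]. Summing over [k] gives [log n / f(0)], while
   the variance of the sum is at most the sum of the second moments, which is
   [O(log n)].
   The closing edge was examined at the first step and is not fresh, but its
   tail is at most a constant times [P(L > t)], so its second moment is bounded.
   Hence [E (T_n - log n / f(0)) ^ 2 = o(log n ^ 2)], and all three
   convergences follow. *)

Require Import Defs.
From mathcomp Require Import all_boot all_order all_algebra finmap ring lra zify.
From mathcomp Require Import all_classical all_reals all_analysis.
From mathcomp Require Import measurable_realfun.

Set Implicit Arguments.
Unset Strict Implicit.
Unset Printing Implicit Defensive.

Import Order.TTheory GRing.Theory Num.Theory.
Import numFieldNormedType.Exports.

Local Open Scope classical_set_scope.
Local Open Scope ring_scope.

(** * Layer cake formulas *)

(** The tour [v] is an arbitrary function of the outcome, not a random variable, so nothing can be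
    conditioned on it. Instead, probabilities are split over the finitely many histories [s]: that
    the tour follows [s] is a statement on comparisons of distances, which lies in the sigma-algebra
    generated by an explicit set of edges, and freshness means that the star examined next avoids
    this set. The tail of the next step is the same for all histories, so it factors out of the sum.
    Only tails are computed: by the layer cake formula, factorization of P(X > s, Y > t) gives E(XY)
    = E(X) E(Y). The second moments sum to O(log n) because a step x satisfies x^2 <= dl * x + x^2
    1(x > dl) for a fixed [dl]: the first terms sum to [dl] times the mean, and the second ones
    decay geometrically in the number of cities left. For the closing edge, fix [m] with 0 <
    [tail m] < 1. Either all distances from city 1 exceed [m], which is exponentially unlikely, or
    the only comparison of the history that involves the closing edge holds as soon as that edge
    exceeds [m]. *)

Section layer_cake.
Local Open Scope ereal_scope.
Context d (T : measurableType d) (R : realType) (P : probability T R).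
Local Notation mu := (@lebesgue_measure R).

(** Tonelli on the region 0 <= s < X(w). The weight [g] allows the formula to be applied to a
    product twice, once for each factor. *)
Lemma ge0_layer_cake (g X : T -> R) :
    measurable_fun setT g -> measurable_fun setT X ->
    (forall w, 0 <= g w)%R -> (forall w, 0 <= X w)%R ->
  \int[P]_w (g w * X w)%:E =
  \int[mu]_(s in `[0%R, +oo[) \int[P]_w (g w * \1_(X @^-1` `]s, +oo[) w)%:E.
Proof.
move=> mg mX g0 X0.
pose k (p : T * measurableTypeR R) : \bar R :=
  (g p.1 * (\1_([set q : T * measurableTypeR R |
    (0 <= q.2)%R && (q.2 < X q.1)%R]) p))%:E.
have k0 p : 0 <= k p by rewrite lee_fin mulr_ge0.
have mk : measurable_fun setT k.
  apply/measurable_EFinP; apply: measurable_funM.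
    exact: (measurableT_comp mg).
  apply: measurable_indic.
  rewrite [X in measurable X](_ : _ = (fun q : T * measurableTypeR R =>
      (0 <= q.2)%R && (q.2 < X q.1)%R) @^-1` [set true]); last first.
    by apply/seteqP; split => p /=.
  rewrite -[X in measurable X]setTI; apply: measurable_and => //.
    exact: measurable_fun_ler.
  by apply: measurable_fun_ltr => //; exact: (measurableT_comp mX).
transitivity (\int[P]_w \int[mu]_s k (w, s)).
  apply: eq_integral => w _.
  under eq_integral => s _.
    rewrite /k/= (_ : \1_ _ _ = \1_(`[0%R, X w[%classic) s); last first.
      by rewrite !indicE; congr (_%:R); congr nat_of_bool; apply/idP/idP;
        rewrite !inE/= in_itv.
    rewrite EFinM; over.
  rewrite ge0_integralZl//; last by rewrite lee_fin.
    rewrite integral_indic// setIT EFinM; congr (_ * _).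
    apply: esym; apply: etrans; first exact: (lebesgue_measure_itv `[0%R, X w[).
    rewrite /= lte_fin; case: ltP => [|h]; first by rewrite EFinN sube0.
    by congr EFin; apply/eqP; rewrite eq_le X0 h.
  by apply/measurable_EFinP; exact: measurable_indic.
rewrite (fubini_tonelli k)// [in RHS]integral_mkcond/=.
apply: eq_integral => s _; rewrite patchE mem_setE in_itv/= andbT.
case: ifPn => s0.
  apply: eq_integral => w _; rewrite /k/=; congr (_ * _)%:E.
  rewrite !indicE; congr (_%:R); congr nat_of_bool; apply/idP/idP.
    by rewrite !inE/= in_itv/= andbT => /andP[].
  by rewrite !inE/= in_itv/= andbT s0.
by apply: integral0_eq => w _; rewrite /k/= indicE memNset ?mulr0//= (negbTE s0).
Qed.

(** Two layer cakes turn E(XY) into a double integral of P(X > s, Y > t), so factorization on upper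
    quadrants is enough. *)
Lemma ge0_expectation_prod (X Y : T -> R) :
    measurable_fun setT X -> measurable_fun setT Y ->
    (forall w, 0 <= X w)%R -> (forall w, 0 <= Y w)%R ->
    (forall s t : R, (0 <= s)%R -> (0 <= t)%R ->
      P (X @^-1` `]s, +oo[ `&` Y @^-1` `]t, +oo[) =
      P (X @^-1` `]s, +oo[) * P (Y @^-1` `]t, +oo[)) ->
  \int[P]_w (X w * Y w)%:E = \int[P]_w (X w)%:E * \int[P]_w (Y w)%:E.
Proof.
move=> mX mY X0 Y0 XY.
have mXs s : measurable (X @^-1` `]s, +oo[).
  by rewrite -[X in measurable X]setTI; exact: mX.
have mYs s : measurable (Y @^-1` `]s, +oo[).
  by rewrite -[X in measurable X]setTI; exact: mY.
have lcY : \int[P]_w (Y w)%:E = \int[mu]_(t in `[0%R, +oo[) P (Y @^-1` `]t, +oo[).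
  under eq_integral do rewrite -[Y _]mul1r.
  rewrite (ge0_layer_cake (g := cst 1%R))//.
  apply: eq_integral => t _; under eq_integral do rewrite mul1r.
  by rewrite integral_indic ?setIT.
have lcX : \int[P]_w (X w)%:E = \int[mu]_(t in `[0%R, +oo[) P (X @^-1` `]t, +oo[).
  under eq_integral do rewrite -[X _]mul1r.
  rewrite (ge0_layer_cake (g := cst 1%R))//.
  apply: eq_integral => t _; under eq_integral do rewrite mul1r.
  by rewrite integral_indic ?setIT.
have mc (Z : T -> R) : measurable_fun setT Z ->
    measurable_fun (`[0%R, +oo[ : set R) (fun t : R => P (Z @^-1` `]t, +oo[)).
  move=> mZ; pose Z' : {RV P >-> R} := mfun_Sub (mem_set mZ).
  by apply: measurable_funTS; exact: (ccdf_measurable Z').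
under eq_integral do rewrite mulrC.
rewrite ge0_layer_cake// lcX muleC -ge0_integralZl//;
  [|exact: mc|by apply: integral_ge0 => w _; rewrite lee_fin].
apply: eq_integral => s; rewrite inE/= in_itv/= andbT => s0.
under eq_integral do rewrite mulrC.
rewrite ge0_layer_cake//; last first.
rewrite lcY -ge0_integralZr//; [| exact: mc].
apply: eq_integral => t; rewrite inE/= in_itv/= andbT => t0.
rewrite (eq_integral (fun w => (\1_(X @^-1` `]s, +oo[ `&` Y @^-1` `]t, +oo[) w)%:E));
  last by move=> w _; rewrite indicI.
rewrite integral_indic//; last exact: measurableI.
by rewrite setIT muleC; exact: XY.
Qed.

(** Layer cake for the squares, since X^2 > r means |X| > sqrt r. There are two probability spaces
    because the tails of the steps will be compared with that of [F] on the real line. *)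
Lemma le_expectation_sqr d' (T' : measurableType d') (P' : probability T' R)
    (X : T -> R) (Y : T' -> R) (C : R) :
    measurable_fun setT X -> measurable_fun setT Y -> (0 <= C)%R ->
    (forall t : R, (0 <= t)%R ->
      P [set w | t < `|X w|]%R <= C%:E * P' [set w | t < `|Y w|]%R) ->
  \int[P]_w ((X w) ^+ 2)%:E <= C%:E * \int[P']_w ((Y w) ^+ 2)%:E.
Proof.
move=> mX mY C0 XY.
have mX2 := measurable_funX 2 mX; have mY2 := measurable_funX 2 mY.
pose X2 : {RV P >-> R} := mfun_Sub (mem_set mX2).
pose Y2 : {RV P' >-> R} := mfun_Sub (mem_set mY2).
have X2E : \int[P]_w ((X w) ^+ 2)%:E = \int[mu]_(r in `[0%R, +oo[) ccdf X2 r.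
  by rewrite -ge0_expectation_ccdf ?unlock// => w; exact: sqr_ge0.
have Y2E : \int[P']_w ((Y w) ^+ 2)%:E = \int[mu]_(r in `[0%R, +oo[) ccdf Y2 r.
  by rewrite -ge0_expectation_ccdf ?unlock// => w; exact: sqr_ge0.
rewrite X2E Y2E -ge0_integralZl//; last first.
  by apply: measurable_funTS; exact: ccdf_measurable.
apply: ge0_le_integral => //.
- by apply: measurable_funTS; exact: ccdf_measurable.
- apply: measurable_funTS; apply: measurable_funeM; exact: ccdf_measurable.
move=> r; rewrite /= in_itv/= andbT => r0.
have sqrtE (x : R) : (r < x ^+ 2)%R = (Num.sqrt r < `|x|)%R.
  by rewrite -[RHS]ltr_sqr ?nnegrE ?sqrtr_ge0// sqr_sqrtr// real_normK ?num_real.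
have := XY _ (sqrtr_ge0 r).
have -> : P [set w | Num.sqrt r < `|X w|]%R = ccdf X2 r.
  apply: (congr1 P).
  by apply/seteqP; split => w /=; rewrite in_itv/= andbT sqrtE.
have -> // : P' [set w | Num.sqrt r < `|Y w|]%R = ccdf Y2 r.
apply: (congr1 P').
by apply/seteqP; split => w /=; rewrite in_itv/= andbT sqrtE.
Qed.

End layer_cake.

(** * Independence *)

Section independence.
Local Open Scope ereal_scope.
Context d d' (Omega : measurableType d) (E : measurableType d') (R : realType)
  (P : probability Omega R) (I : choiceType) (X : I -> {RV P >-> E}).

(** The pi-system generating the sigma-algebra of the [X i] with [i] in [D]. That sigma-algebra is
    kept as a set of subsets of [Omega], so that [P] applies directly to its members. *)
Definition cylinder (D : set I) : set (set Omega) :=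
  [set G | exists (J : {fset I}) (B : I -> set E),
    [/\ forall i, i \in J -> D i, forall i, measurable (B i) &
        G = \bigcap_(i in [set i | i \in J]) (X i @^-1` B i)]].

Lemma cylinder_setI D : setI_closed (cylinder D).
Proof.
move=> _ _ [J [B [JD mB ->]]] [J' [B' [JD' mB' ->]]].
exists (J `|` J')%fset.
exists (fun i => (if i \in J then B i else setT) `&` (if i \in J' then B' i else setT)).
split.
- by move=> i; rewrite in_fsetU => /orP[/JD|/JD'].
- by move=> i; apply: measurableI; case: ifP.
apply/seteqP; split => [w [h h'] i /= _|w h].
  by split; case: ifPn => // iJ; [exact: h|exact: h'].
split => i /= iJ; have := h i; rewrite /= in_fsetU iJ ?orbT => /(_ isT).
  by case.
by case.
Qed.

Lemma measurable_cylinder D G : cylinder D G -> measurable G.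
Proof.
move=> [J [B [_ mB ->]]]; apply: fin_bigcap_measurable; first exact: finite_fset.
by move=> i _; rewrite -[X in measurable X]setTI; exact: measurable_funPT.
Qed.

Definition sigma_of (D : set I) : set (set Omega) := <<s cylinder D >>.

Lemma measurable_sigma_of D G : sigma_of D G -> measurable G.
Proof.
move=> /(_ measurable); apply; split; first exact: sigma_algebra_measurable.
exact: measurable_cylinder.
Qed.

Lemma sigma_of_preimage (D : set I) i B : D i -> measurable B ->
  sigma_of D (X i @^-1` B).
Proof.
move=> Di mB; apply: sub_sigma_algebra.
exists [fset i]%fset, (fun=> B); split => //.
  by move=> j; rewrite inE => /eqP ->.
apply/seteqP; split => [w h j|w h]; first by rewrite /= inE => /eqP ->.
by apply: h; rewrite /= inE.
Qed.

(** Dynkin's pi-lambda argument: the events independent of the fixed cylinder over [J] form a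
    lambda-system, which contains the cylinders over [D] because [J] avoids [D]. *)
Lemma sigma_of_indep (D0 D : set I) (J : {fset I}) (B : I -> set E) G :
    mutually_independent D0 X -> D `<=` D0 ->
    (forall i, i \in J -> D0 i /\ ~ D i) ->
    (forall i, measurable (B i)) ->
    sigma_of D G ->
  P (G `&` \bigcap_(i in [set i | i \in J]) (X i @^-1` B i)) =
    P G * \prod_(i <- J) P (X i @^-1` B i).
Proof.
move=> ind DD0 JD mB sG.
set C := \bigcap_(i in _) _.
have mC : measurable C.
  by apply: (@measurable_cylinder D0); exists J, B; split => // i /JD[].
have PC : P C = \prod_(i <- J) P (X i @^-1` B i) by apply: ind => // i /JD[].
rewrite -PC.
suff : sigma_of D `<=` [set A | measurable A /\ P (A `&` C) = P A * P C].
  by move=> /(_ _ sG) [].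
apply: lambda_system_subset; [exact: cylinder_setI| | |by []].
  apply/dynkin_lambda_system; split.
  - by split => //; rewrite setTI probability_setT mul1e.
  - move=> A [mA PA]; split; first exact: measurableC.
    have -> : ~` A `&` C = C `\` (A `&` C).
      by rewrite setDE setCI setIUr setICr setU0 setIC.
    have mAC := measurableI _ _ mA mC.
    have PD : P (C `\` (A `&` C)) = P C - P (A `&` C).
      rewrite measureD//; last by rewrite ltey_eq fin_num_measure.
      by rewrite setICA setIid.
    rewrite PD PA probability_setC// muleBl ?mul1e ?fin_num_measure//.
  - move=> F tF FP; split; first by apply: bigcup_measurable => k _; case: (FP k).
    rewrite setI_bigcupl measure_bigcup//=; last 2 first.
    + by move=> k _; apply: measurableI => //; case: (FP k).
    + move/trivIsetP : tF => tF; apply/trivIsetP => i j _ _ ij.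
      by rewrite setIACA setIid tF// set0I.
    rewrite measure_bigcup//=; last by move=> k _; case: (FP k).
    rewrite muleC -[X in X * _](fineK (fin_num_measure P _ mC)) -nneseriesZl//.
    apply: eq_eseriesr => k _; rewrite fineK ?fin_num_measure// muleC.
    by case: (FP k).
move=> A [J' [B' [JD' mB' AE]]]; split.
  by apply: (@measurable_cylinder D); exists J', B'.
(* As the index sets are disjoint, the two cylinders glue into one over the union, to which mutual
   independence applies. *)
pose B'' i := if i \in J then B i else B' i.
have disj i : i \in J -> i \in J' -> False by move=> /JD[_ h] /JD' /h.
have -> : A `&` C = \bigcap_(i in [set i | i \in (J' `|` J)%fset]) (X i @^-1` B'' i).
  rewrite AE; apply/seteqP; split.
    move=> w [h h'] i /=; rewrite in_fsetU /B''; case: ifPn => iJ.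
      by move=> _; exact: h'.
    by rewrite orbF; exact: h.
  move=> w h; split => i /= iJ; have := h i;
    rewrite /= in_fsetU iJ ?orbT /B'' => /(_ isT).
    by case: ifPn => // iJ'; case: (disj _ iJ' iJ).
  by rewrite iJ.
rewrite ind; last 2 first.
- by move=> i; rewrite in_fsetU => /orP[/JD' /DD0|/JD[]].
- by move=> i; rewrite /B''; case: ifP.
rewrite AE ind => [|i /JD' /DD0|]//.
rewrite PC.
rewrite (perm_big (J' ++ J)) /=; last first.
  apply: uniq_perm => [||i]; rewrite ?fset_uniq// ?mem_cat ?in_fsetU//.
  rewrite cat_uniq !fset_uniq andbT/=; apply/hasPn => i iJ /=.
  by apply/negP; exact: disj.
rewrite big_cat/=.
congr (_ * _); rewrite big_seq [RHS]big_seq; apply: eq_bigr => i iJ; rewrite /B''.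
  by case: ifPn => // iJ'; case: (disj _ iJ' iJ).
by rewrite iJ.
Qed.

End independence.

Section ties.
Local Open Scope ereal_scope.
Context d (Omega : measurableType d) (R : realType) (P : probability Omega R).

(** The law of (X, Y) is the product of the marginal laws, and each section of the diagonal is a
    singleton, which the law of [Y] does not charge. *)
Lemma indep_tie_null (X Y : {RV P >-> R}) :
    (forall A B : set R, measurable A -> measurable B ->
      P (X @^-1` A `&` Y @^-1` B) = P (X @^-1` A) * P (Y @^-1` B)) ->
    (forall x : R, P (Y @^-1` [set x]) = 0) ->
  P [set w | X w = Y w] = 0.
Proof.
move=> XY Y0.
have mXY : measurable_fun setT (fun w => (X w, Y w)) by exact: measurable_fun_pair.
pose XYm : {mfun Omega >-> (R * R)%type} := mfun_Sub (mem_set mXY).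
pose D : set (R * R) := [set p | p.1 = p.2].
have mD : measurable D.
  rewrite (_ : D = (fun p : R * R => p.1 == p.2) @^-1` [set true]); last first.
    by apply/seteqP; split => p /= /eqP.
  by rewrite -[X in measurable X]setTI; exact: measurable_fun_eqr.
have <- : (distribution P X \x distribution P Y) D = P [set w | X w = Y w].
  by rewrite (product_measure_unique (m' := pushforward P XYm)).
rewrite /product_measure1 /=; apply: integral0_eq => x _ /=.
have -> : xsection D x = [set x]; last exact: Y0.
by apply/seteqP; split => y; rewrite /xsection /= inE /D /= => ->.
Qed.

End ties.

(** * Histories of nearest neighbor tours *)

Section history.
Variables (R : realType) (n : nat).
Local Notation V := 'I_n.+1.
Implicit Types (l : V -> V -> R) (s : seq V) (p : rel V) (v : nat -> V).

(* Visited cities are listed latest first. Only the comparisons [l x y] with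
   [p x y] are made, so that one distance can be left out of the history. *)
Fixpoint hist p l s : bool :=
  if s is u :: ((x :: _) as s') then
    [&& hist p l s', p x u &
        [forall y, (y \notin s) && p x y ==> (l x u < l x y)]]
  else true.

Arguments hist : simpl never.

Lemma histE p l u x s : hist p l [:: u, x & s] =
  [&& hist p l (x :: s), p x u &
      [forall y, (y \notin [:: u, x & s]) && p x y ==> (l x u < l x y)]].
Proof. by []. Qed.

Fixpoint trace v i : seq V := if i is j.+1 then v j.+1 :: trace v j else [::].

Lemma size_trace v i : size (trace v i) = i.
Proof. by elim: i => //= i ->. Qed.

Lemma nth_trace v i j : (j < i)%N -> nth ord0 (trace v i) j = v (i - j)%N.
Proof.
elim: i j => //= i IH [|j]; first by rewrite subn0.
by rewrite ltnS => /IH /= ->; rewrite subSS.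
Qed.

Lemma mem_traceP v i y :
  reflect (unvisited v i y) (y \notin trace v i).
Proof.
apply: (iffP idP) => [|uv].
  elim: i => [_ [|j]//|i IH]; rewrite /= inE negb_or => /andP[yi /IH uv] j.
  move=> /andP[j1]; rewrite leq_eqVlt => /orP[/eqP ->|ji]; first exact/eqP.
  by apply: uv; rewrite j1.
elim: i uv => // i IH uv; rewrite /= inE negb_or; apply/andP; split.
  by apply/eqP; apply: uv; rewrite leqnn.
by apply: IH => j /andP[j1 ji]; apply: uv; rewrite j1 (leq_trans ji).
Qed.

Definition start_path s := uniq s && (last ord0 s == ord0).

Definition star_lt l s (t : R) := [forall y, (y \notin s) ==> (t < l (head ord0 s) y)].

Section tour.
Variables (l : V -> V -> R) (v : nat -> V).
Hypothesis vNN : is_NN_tour l ord0 v.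

Lemma uniq_trace i : (i <= n.+1)%N -> uniq (trace v i).
Proof.
case: vNN => _ step _; elim: i => //= -[|i] IH iN //.
rewrite IH ?(ltnW iN)// andbT.
by apply/mem_traceP; have [] := step i.+1 iN.
Qed.

Lemma last_trace i : (0 < i)%N -> last ord0 (trace v i) = ord0.
Proof.
case: vNN => v1 _ _; case: i => //= i _; elim: i => //=.
Qed.

Lemma start_path_trace i : (0 < i <= n.+1)%N -> start_path (trace v i).
Proof. by case/andP=> i0 iN; rewrite /start_path uniq_trace// last_trace/=. Qed.

Lemma tour_nth i : (0 < i <= n.+2)%N ->
  v i = nth ord0 (rev (trace v n.+1)) i.-1.
Proof.
case: i => // i /andP[_]; rewrite ltnS leq_eqVlt succnK => /orP[/eqP ->|iN].
  (* The return to the start is the default value of [nth]: position [n.+1] is out of range. *)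
  by case: vNN => _ _ ->; rewrite nth_default// size_rev size_trace.
rewrite nth_rev ?size_trace// nth_trace; last by rewrite subSS ltnS leq_subr.
by congr v; rewrite subKn.
Qed.

(** The step is a minimum over a star. Written on the star, the event no longer mentions the next
    city. *)
Lemma step_ltP i (t : R) : (0 < i <= n)%N ->
  (t < l (v i) (v i.+1)) = star_lt l (trace v i) t.
Proof.
case: i => // i iN; case: vNN => _ step _.
have [uv vmin] := step i.+1 iN.
apply/idP/forallP => [lt y|h].
  apply/implyP => /mem_traceP yi /=; apply: lt_le_trans lt _; exact: vmin.
by have /implyP := h (v i.+2); apply; apply/mem_traceP.
Qed.

Hypothesis notie : forall x y z : V, x != y -> x != z -> y != z -> l x y != l x z.

Lemma hist_trace i : (i <= n.+1)%N -> hist (fun _ _ => true) l (trace v i).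
Proof.
elim: i => // -[//|i] IH iN.
rewrite [trace v i.+2]/= histE IH ?(ltnW iN)//=.
have := uniq_trace iN => /= /andP[vi2 /andP[vi1 _]].
case: vNN => _ step _; have [_ vmin] := step i.+1 iN.
apply/forallP => y; apply/implyP; rewrite andbT inE negb_or => /andP[yv yi].
rewrite lt_neqAle vmin ?andbT; last by apply/mem_traceP.
move: vi2 yi; rewrite !inE !negb_or => /andP[v21 _] /andP[y1 _].
by apply: notie; rewrite eq_sym// eq_sym.
Qed.

(** The comparisons of [hist] are strict, which leaves no choice: if [s] and the tour disagreed on
    the next city, that of [s] would be strictly nearer than that of the tour, which is a nearest
    one. *)
Lemma hist_eq_trace s : (size s <= n.+1)%N -> start_path s ->
  hist (fun _ _ => true) l s -> s = trace v (size s).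
Proof.
case: s => // x s; elim: s x => [|x s IH] u.
  by move=> _ /andP[_ /= /eqP ->] _; case: vNN => /= ->.
rewrite histE => sN /andP[/= /andP[us uxs] lasts] /andP[h /forallP hmin].
have /IH := h => /(_ (ltnW sN)); rewrite /start_path /= uxs lasts => /(_ isT) E.
have step : x :: s = v (size s).+1 :: trace v (size s) by exact: E.
rewrite step; congr cons; apply/eqP; apply: contraTT isT => uv.
case: vNN => _ st _; have [/mem_traceP vnew vmin] := st (size s).+1 sN.
have xE : x = v (size s).+1 by case: step.
have := hmin (v (size s).+2) => /implyP.
rewrite andbT inE negb_or eq_sym uv step => /(_ vnew).
rewrite xE ltNge vmin//.
by apply/mem_traceP; rewrite /= -step.
Qed.

End tour.


Definition skip (u : V) : rel V := fun x y => ~~ ((x == ord0) && (y == u)).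

(** The comparison dropped by [skip u] can only occur at the first step. Since [s] lists the latest
    city first, [nth u s (size s).-2] is the second city; when it differs from [u], the skipped edge
    is never the chosen one. *)
Lemma hist_skip u l s : uniq s -> last ord0 s = ord0 -> nth u s (size s).-2 != u ->
  hist (fun _ _ => true) l s -> hist (skip u) l s.
Proof.
elim: s => // y [//|x s] IH /= /andP[ys us] lasts su.
rewrite !histE => /and3P[h _ /forallP hmin].
have -> /= : hist (skip u) l (x :: s).
  case: s IH ys us lasts su h hmin => // x' s IH ys us lasts su h hmin.
  exact: IH.
apply/andP; split.
  case: s {IH h hmin ys} us lasts su => [|x' s] /= us lasts su.
    by rewrite /skip (negbTE su) andbF.
  rewrite /skip (_ : x == ord0 = false)//; apply/negbTE; move/andP: us => [us _].
  by apply: contraNN us => /eqP ->; rewrite -{1}lasts mem_last.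
apply/forallP => z; have := hmin z; rewrite andbT => /implyP hz.
by apply/implyP => /andP[/hz].
Qed.

Lemma hist_unskip u l s : uniq s -> last ord0 s = ord0 ->
  l ord0 (nth u s (size s).-2) < l ord0 u ->
  hist (skip u) l s -> hist (fun _ _ => true) l s.
Proof.
elim: s => // y [//|x s] IH /= /andP[ys us] lasts su.
rewrite !histE => /and3P[h _ /forallP hmin].
have -> /= : hist (fun _ _ => true) l (x :: s).
  case: s IH ys us lasts su h hmin => // x' s IH ys us lasts su h hmin.
  exact: IH.
apply/forallP => z; have := hmin z; rewrite andbT => /implyP hz.
apply/implyP => zs; have [/andP[/eqP xE /eqP zE]|zp] := boolP ((x == ord0) && (z == u)).
  rewrite xE zE; case: s us lasts su {IH h hmin hz ys zs} => // x' s.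
  rewrite /= xE => /andP[+ _] lasts.
  by rewrite -{1}lasts mem_last.
by apply: hz; rewrite zs.
Qed.

End history.
Arguments hist {R n} p l s : simpl never.

Lemma fsbig_setT_index (R : realType) (I : finType) (f : I -> \bar R) :
  (\sum_(i \in [set: I]) f i = \sum_(i : I) f i)%E.
Proof.
have -> : [set: I] = [set` index_enum I].
  by apply/seteqP; split => // i _ /=; rewrite mem_index_enum.
by rewrite -fsbig_seq ?index_enum_uniq.
Qed.

Lemma measure_fin_partition d (T : measurableType d) (R : realType)
    (mu : {measure set T -> \bar R}) (I : finType) (Z : I -> set T) (A : set T) :
    (forall i, measurable (Z i)) -> trivIset setT Z -> A = \bigcup_i Z i ->
  mu A = (\sum_(i : I) mu (Z i))%E.
Proof.
move=> mZ tZ ->; rewrite measure_fin_bigcup//=.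
by rewrite fsbig_setT_index.
Qed.

Lemma measure_fin_le d (T : measurableType d) (R : realType)
    (mu : {measure set T -> \bar R}) (I : finType) (Z : I -> set T) (A : set T) :
    (forall i, measurable (Z i)) -> measurable A -> A `<=` \bigcup_i Z i ->
  (mu A <= \sum_(i : I) mu (Z i))%E.
Proof.
move=> mZ mA AZ; rewrite -fsbig_setT_index; apply: content_sub_fsum => //.
exact: finite_finset.
Qed.

(** * Fresh edges, and the almost sure absence of ties *)

Section edges.
Variable n : nat.
Local Notation V := 'I_n.+1.

(** Independence is assumed for increasing pairs only, so each distance is addressed through its
    increasing representative. *)
Definition edge (i j : V) : V * V := if (i < j)%N then (i, j) else (j, i).

Lemma edge_lt i j : i != j -> ((edge i j).1 < (edge i j).2)%N.
Proof.
move=> ij; rewrite /edge; case: (ltngtP i j) => [//|//|/val_inj E].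
by rewrite E eqxx in ij.
Qed.

Lemma edge_inj x y x' y' : edge x y = edge x' y' ->
  (x = x' /\ y = y') \/ (x = y' /\ y = x').
Proof. by rewrite /edge; case: ifP => _; case: ifP => _ [-> ->]; auto. Qed.

End edges.

Section nearest_neighbour.
Context (R : realType) (F : probability (measurableTypeR R) R)
  d (Omega : measurableType d) (P : probability Omega R) (n : nat).
Local Notation V := 'I_n.+1.
Variable L : V -> V -> {RV P >-> R}.
Hypothesis L_iid : iid_distances F L.
Hypothesis F_nneg : supported_nneg F.
Hypothesis F_atomless : forall x : R, F [set x] = 0%E.

Local Notation l w := (fun i j => L i j w).
Local Notation X := (fun ij : V * V => L ij.1 ij.2).
Definition all_edges : set (V * V) := [set e : V * V | (e.1 < e.2)%N].

Lemma L_edge i j w : X (edge i j) w = L i j w.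
Proof. by case: L_iid => LC _ _; rewrite /edge; case: ifP. Qed.

Lemma L_edge_preimage i j B : X (edge i j) @^-1` B = L i j @^-1` B.
Proof. by apply/seteqP; split => w /=; rewrite L_edge. Qed.

Lemma L_law i j (B : set R) : i != j -> measurable B -> P (L i j @^-1` B) = F B.
Proof.
move=> ij mB; case: L_iid => _ law _; rewrite -L_edge_preimage.
exact: law (edge_lt ij) _ mB.
Qed.

Local Open Scope ereal_scope.

(** This is freshness: the distances from [x] to [S] are independent of all that the edges in [D]
    determine. With [B] a half-line, the power of [F B] becomes the tail of a minimum. *)
Lemma star_indep (D : set (V * V)) x (S : {set V}) (B : set R) G :
    D `<=` all_edges -> (forall y, y \in S -> y != x /\ ~ D (edge x y)) ->
    measurable B -> sigma_of X D G ->
  P (G `&` [set w | forall y, y \in S -> B (L x y w)]) =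
    P G * (fine (F B) ^+ #|S|)%:E.
Proof.
move=> DE SD mB sG.
have -> : [set w | forall y, y \in S -> B (L x y w)] =
    \bigcap_(e in [set e | e \in [fset edge x y | y in S]%fset]) (X e @^-1` B).
  apply/seteqP; split=> [w h e /=|w h y yS].
    by move=> /imfsetP[y /= yS ->]; rewrite L_edge; exact: h.
  rewrite -L_edge; apply: (h (edge x y)); apply/imfsetP.
  by exists y.
have [_ _ ind] := L_iid.
rewrite (sigma_of_indep (B := fun=> B) ind DE)//; last first.
  move=> e /imfsetP[y /= yS ->]; have [yx nD] := SD _ yS; split => //.
  by apply: edge_lt; rewrite eq_sym.
congr (_ * _).
rewrite big_imfset/=; last first.
  move=> y y' yS _ /edge_inj[[]//|[xy' yx]].
  by have [] := SD _ yS; rewrite yx eqxx.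
rewrite (eq_big_seq (fun=> (fine (F B))%:E)); last first.
  move=> y; rewrite mem_enum => yS.
  rewrite L_edge_preimage L_law ?fineK ?fin_num_measure//.
  by have [] := SD _ yS; rewrite eq_sym.
by rewrite prodEFin big_const_seq count_predT iter_mulr_1 -cardE.
Qed.

(** Measurability in [Omega] would not do: the comparison has to stay in the sigma-algebra of [D],
    hence the separation by a rational. *)
Lemma sigma_of_lt (D : set (V * V)) a b c e : D (edge a b) -> D (edge c e) ->
  sigma_of X D [set w | (L a b w < L c e w)%R].
Proof.
move=> Dab Dce.
have -> : [set w | (L a b w < L c e w)%R] = \bigcup_(q : rat)
    ((X (edge a b) @^-1` [set x | (x < ratr q)%R]) `&`
     (X (edge c e) @^-1` [set x | (ratr q < x)%R])).
  apply/seteqP; split => w /=.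
    move=> /rat_in_itvoo[q]; rewrite in_itv/= => /andP[q1 q2].
    by exists q => //=; rewrite !L_edge.
  by move=> [q _ /=]; rewrite !L_edge => -[]; exact: lt_trans.
apply: (@bigcupT_measurable_rat _ (g_sigma_algebraType (cylinder X D))) => q.
apply: measurableI; apply: sigma_of_preimage => //.
  by rewrite -set_itvNyo; exact: measurable_itv.
by rewrite -set_itvoy; exact: measurable_itv.
Qed.

(** All comparisons of a history are made from cities of [behead s]. The edges from the current city
    to the unvisited ones do not enter, nor do those that [p] leaves out. *)
Lemma sigma_of_hist (D : set (V * V)) (p : rel V) (s : seq V) : uniq s ->
    (forall x y, x \in behead s -> y != x -> p x y -> D (edge x y)) ->
  sigma_of X D [set w | hist p (l w) s].
Proof.
elim: s => [_ _|u [|x s] IH us sD].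
- have -> : [set w | hist p (l w) [::]] = setT by apply/seteqP; split.
  exact: (@measurableT _ (g_sigma_algebraType (cylinder X D))).
- have -> : [set w | hist p (l w) [:: u]] = setT by apply/seteqP; split.
  exact: (@measurableT _ (g_sigma_algebraType (cylinder X D))).
have [pxu|npxu] := boolP (p x u); last first.
  rewrite (_ : [set w | _] = set0).
    exact: (@measurable0 _ (g_sigma_algebraType (cylinder X D))).
  by apply/seteqP; split => w /=; first by rewrite histE (negbTE npxu) andbF.
have -> : [set w | hist p (l w) [:: u, x & s]] =
    [set w | hist p (l w) (x :: s)] `&`
    \bigcap_(y in [set y | (y \notin [:: u, x & s]) && p x y])
      [set w | (L x u w < L x y w)%R].
  apply/seteqP; split => w /=; rewrite histE pxu/=.
    by move=> /andP[h /forallP hy]; split => // y /= yp; have /implyP := hy y; apply.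
  by move=> [-> h]; apply/forallP => y; apply/implyP => yp; exact: h.
apply: (@measurableI _ (g_sigma_algebraType (cylinder X D))).
  apply: IH; first by case/andP: us.
  by move=> x' y /= x's; apply: sD; rewrite /= inE x's orbT.
apply: (@fin_bigcap_measurable _ (g_sigma_algebraType (cylinder X D))).
  exact: finite_finset.
move=> y /= /andP[ys pxy].
apply: sigma_of_lt; apply: sD; rewrite ?mem_head//.
  by move: us; rewrite /= inE negb_or => /andP[/andP[]].
by move: ys; rewrite !inE !negb_or => /and3P[].
Qed.

Lemma measurable_hist p s : uniq s -> measurable [set w | hist p (l w) s].
Proof.
move=> us; apply: (@measurable_sigma_of _ _ _ _ _ _ _ X all_edges).
apply: sigma_of_hist => // x y _ yx _.
by apply: edge_lt; rewrite eq_sym.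
Qed.

(** Ties are excluded between edges with a common endpoint, the only ones that a nearest neighbor
    tour compares. The complement is a finite union of null events. *)
Definition generic : set Omega :=
  [set w | (forall i j : V, i != j -> 0 <= L i j w)%R /\
   (forall x y z : V, x != y -> x != z -> y != z -> L x y w != L x z w)].

Lemma genericE : generic =
  ~` ((\bigcup_(e : V * V) [set w | e.1 != e.2 /\ (L e.1 e.2 w < 0)%R]) `|`
      \bigcup_(e : V * (V * V))
        [set w | [&& e.1 != e.2.1, e.1 != e.2.2 & e.2.1 != e.2.2] /\
                 L e.1 e.2.1 w = L e.1 e.2.2 w]).
Proof.
apply/seteqP; split.
  move=> w [h h'] /= [[[i j] _ /= [ij]]|[[x [y z]] _ /= [/and3P[xy xz yz]]]].
- by rewrite ltNge h.
- by apply/eqP; exact: h'.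
move=> w /= h; split => [i j ij|x y z xy xz yz].
  by rewrite leNgt; apply/negP => lt0; apply: h; left; exists (i, j) => //; split.
by apply/eqP => E; apply: h; right; exists (x, (y, z)) => //=; rewrite xy xz yz.
Qed.

Let mL0 i j : measurable [set w | (L i j w < 0)%R].
Proof.
rewrite (_ : [set w | _] = L i j @^-1` `]-oo, 0%R[); last first.
  by apply/seteqP; split => w /=; rewrite in_itv.
by rewrite -[X in measurable X]setTI; exact: measurable_funPT.
Qed.

Let mtie (x y z : V) : measurable [set w | L x y w = L x z w].
Proof.
rewrite (_ : [set w | _] = (fun w => L x y w == L x z w) @^-1` [set true]); last first.
  by apply/seteqP; split => w /= /eqP.
by rewrite -[X in measurable X]setTI; exact: measurable_fun_eqr.
Qed.

Let tie0 (x y z : V) : x != y -> x != z -> y != z -> P [set w | L x y w = L x z w] = 0.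
Proof.
move=> xy xz yz; apply: indep_tie_null => [A B mA mB|r].
  have h := @star_indep [set edge x y] x [set z]%SET B (L x y @^-1` A).
  rewrite (_ : _ `&` _ = L x y @^-1` A `&`
      [set w | forall y0, y0 \in [set z]%SET -> B (L x y0 w)]).
    rewrite h//.
    - by rewrite cards1 expr1 fineK ?fin_num_measure// [X in _ = _ * X]L_law.
    - by move=> _ ->; exact: edge_lt.
    - move=> y'; rewrite inE => /eqP ->; split; first by rewrite eq_sym.
      by move=> /edge_inj[[_ E]|[E _]]; [rewrite E eqxx in yz|rewrite E eqxx in xy].
    - by rewrite -L_edge_preimage; exact: sigma_of_preimage.
  apply/seteqP; split => w /= [wA wB]; split => //.
    by move=> y0; rewrite inE => /eqP ->.
  by apply: wB; rewrite inE.
by rewrite L_law.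
Qed.

Let mneg (e : V * V) : measurable [set w | e.1 != e.2 /\ (L e.1 e.2 w < 0)%R].
Proof.
case: (eqVneq e.1 e.2) => ee; last first.
  rewrite (_ : [set _ | _] = [set w | (L e.1 e.2 w < 0)%R])//.
  by apply/seteqP; split => w /= [].
by rewrite (_ : [set _ | _] = set0)//; apply/seteqP; split => w /= [].
Qed.

Let mties (e : V * (V * V)) : measurable
  [set w | [&& e.1 != e.2.1, e.1 != e.2.2 & e.2.1 != e.2.2] /\
           L e.1 e.2.1 w = L e.1 e.2.2 w].
Proof.
case: [&& _, _ & _]; last first.
  by rewrite (_ : [set _ | _] = set0)//; apply/seteqP; split => w /= [].
rewrite (_ : [set _ | _] = [set w | L e.1 e.2.1 w = L e.1 e.2.2 w])//.
by apply/seteqP; split => w /= [].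
Qed.

Lemma measurable_generic : measurable generic.
Proof.
rewrite genericE; apply: measurableC; apply: measurableU;
  by (apply: fin_bigcup_measurable; first exact: finite_finset).
Qed.

Lemma generic_null : P (~` generic) = 0.
Proof.
rewrite genericE setCK; apply/eqP; rewrite -measure_le0.
have mB1 : measurable (\bigcup_(e : V * V) [set w | e.1 != e.2 /\ (L e.1 e.2 w < 0)%R]).
  by (apply: fin_bigcup_measurable; first exact: finite_finset).
have mB2 : measurable (\bigcup_(e : V * (V * V))
        [set w | [&& e.1 != e.2.1, e.1 != e.2.2 & e.2.1 != e.2.2] /\
                 L e.1 e.2.1 w = L e.1 e.2.2 w]).
  by (apply: fin_bigcup_measurable; first exact: finite_finset).
apply: (le_trans (measureU2 _ mB1 mB2)).
rewrite -[leRHS]adde0; apply: leeD.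
  apply: (le_trans (measure_fin_le P mneg mB1 _)) => //.
  rewrite big1// => -[i j] _ /=; have [->|ij] := eqVneq i j.
    by rewrite (_ : [set _ | _] = set0) ?measure0//; apply/seteqP; split => w /= [].
  rewrite (_ : [set _ | _] = L i j @^-1` [set x | (x < 0)%R]).
    by rewrite L_law// -set_itvNyo; exact: measurable_itv.
  by apply/seteqP; split => w /= [].
apply: (le_trans (measure_fin_le P mties mB2 _)) => //.
rewrite big1// => -[x [y z]] _ /=; have [/and3P[xy xz yz]|] := boolP [&& _, _ & _].
  rewrite (_ : [set _ | _] = [set w | L x y w = L x z w]) ?tie0//.
  by apply/seteqP; split => w /= [].
by rewrite (_ : [set _ | _] = set0) ?measure0//; apply/seteqP; split => w /= [].
Qed.

Lemma measureI_generic A : measurable A -> P (A `&` generic) = P A.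
Proof.
move=> mA; have mg := measurable_generic.
rewrite [RHS](measureDI P mA mg) [X in X + _](_ : _ = 0) ?add0e//.
apply: (subset_measure0 (B := ~` generic)) generic_null.
- exact: measurableD.
- exact: measurableC.
- by move=> w [].
Qed.

End nearest_neighbour.

(** * Law of the steps *)

Section steps.
Context (R : realType) (F : probability (measurableTypeR R) R)
  d (Omega : measurableType d) (P : probability Omega R) (n : nat).
Local Notation V := 'I_n.+1.
Variable L : V -> V -> {RV P >-> R}.
Hypothesis L_iid : iid_distances F L.
Hypothesis F_nneg : supported_nneg F.
Hypothesis F_atomless : forall x : R, F [set x] = 0%E.
Variable v : Omega -> nat -> V.
Hypothesis v_NN : forall w, is_NN_tour (fun i j => L i j w) ord0 (v w).

Local Notation l w := (fun i j => L i j w).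
Local Notation X := (fun ij : V * V => L ij.1 ij.2).
Local Notation generic := (generic L).

Let NN : (0 < n.+1 <= n.+1)%N. Proof. exact: leqnn. Qed.

Definition path_event i (s : i.-tuple V) : set Omega :=
  [set w | start_path s && hist (fun _ _ => true) (l w) s].

(* The choice of [v] at ties need not be measurable: cancelling the steps outside
   the almost sure event [generic] makes them measurable. *)
Definition step i (w : Omega) : R := \1_generic w * `|L (v w i) (v w i.+1) w|.

(* The absolute value costs nothing, as [F] charges only nonnegative reals, and
   makes all variables nonnegative everywhere. *)
Definition tail (t : R) : R := fine (F [set x : R | t < `|x|]).

Lemma measurable_abs_gt (t : R) : measurable [set x : R | t < `|x|].
Proof.
rewrite (_ : [set _ | _] = (@Num.norm _ R) @^-1` `]t, +oo[).
  rewrite -[X in measurable X]setTI.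
  exact: (@normr_measurable R setT).
by apply/seteqP; split => x /=; rewrite in_itv/= andbT.
Qed.

Lemma tail_ge0 t : 0 <= tail t.
Proof. exact: fine_ge0. Qed.

Lemma tailE t : (tail t)%:E = F [set x : R | t < `|x|].
Proof. by rewrite fineK ?fin_num_measure//; exact: measurable_abs_gt. Qed.

Lemma measurable_path_event i (s : i.-tuple V) : measurable (path_event s).
Proof.
have [sp|/negbTE sp] := boolP (start_path s).
  rewrite (_ : path_event s = [set w | hist (fun _ _ => true) (l w) s]).
    by apply: measurable_hist L_iid _ _ _; case/andP: sp.
  by apply/seteqP; split => w; rewrite /path_event/= sp.
rewrite (_ : path_event s = set0)//; apply/seteqP; split => w //=.
by rewrite /path_event/= sp.
Qed.

Lemma path_eventP i (s : i.-tuple V) w : generic w -> (0 < i <= n.+1)%N ->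
  path_event s w <-> tval s = trace (v w) i.
Proof.
move=> [_ notie] iN; split.
  move=> /andP[sp hs]; rewrite -[in RHS](size_tuple s).
  by apply: (hist_eq_trace (v_NN w)) => //; rewrite size_tuple; case/andP: iN.
move=> E; rewrite /path_event/= E (start_path_trace (v_NN w))//=.
by apply: (hist_trace (v_NN w)) => //; case/andP: iN.
Qed.

(** This replaces conditioning on the first [i] cities: on [generic], exactly one history of length
    [i] is realized. *)
Lemma path_partition A i : measurable A -> (0 < i <= n.+1)%N ->
  P A = (\sum_(s : i.-tuple V) P (A `&` generic `&` path_event s))%E.
Proof.
move=> mA iN; rewrite -(measureI_generic L_iid F_nneg F_atomless mA).
have mg := measurable_generic L.
apply: measure_fin_partition.
- by move=> s; apply: measurableI; [exact: measurableI|exact: measurable_path_event].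
- apply/trivIsetP => s s' _ _ ss'; apply/seteqP; split => w //= [[[_ gw] pw] [_ pw']].
  move/eqP: ss'; apply; apply: val_inj => /=.
  by move/(path_eventP _ gw iN) : pw => ->; move/(path_eventP _ gw iN) : pw' => ->.
apply/seteqP; split => [w [Aw gw]|w [s _ [[]]]//].
exists (Tuple (introT eqP (size_trace (v w) i))) => //; split => //.
exact/(path_eventP _ gw iN).
Qed.

Lemma step_path i (s : n.+1.-tuple V) w : generic w -> (0 < i <= n.+1)%N ->
  path_event s w ->
  step i w = `|L (nth ord0 (rev s) i.-1) (nth ord0 (rev s) i) w|.
Proof.
move=> gw /andP[i0 iN] /(path_eventP _ gw NN) ->.
rewrite /step indicE mem_set// mul1r (tour_nth (v_NN w) (i := i)) ?i0 ?(leq_trans iN)//.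
by rewrite (tour_nth (v_NN w) (i := i.+1)).
Qed.

(** Along a fixed complete path the step is a fixed edge. The formula does not mention [v], and
    measurability of the step follows from it. *)
Lemma stepE i : (0 < i <= n.+1)%N -> step i = fun w =>
  \sum_(s : n.+1.-tuple V) \1_(generic `&` path_event s) w *
      `|L (nth ord0 (rev s) i.-1) (nth ord0 (rev s) i) w|.
Proof.
move=> iN; apply/funext => w.
have [gw|ngw] := pselect (generic w); last first.
  rewrite /step indicE memNset// mul0r big1// => s _.
  by rewrite indicE memNset ?mul0r// => -[].
pose s0 : n.+1.-tuple V := Tuple (introT eqP (size_trace (v w) n.+1)).
have s0w : path_event s0 w by apply/(path_eventP _ gw NN).
rewrite (bigD1 s0)//= indicE mem_set// mul1r big1 ?addr0; last first.
  move=> s /eqP ss0; rewrite indicE memNset ?mul0r// => -[_ /(path_eventP _ gw NN) E].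
  by apply: ss0; exact: val_inj.
by rewrite (step_path gw iN s0w).
Qed.

Lemma step_generic i w : generic w -> step i w = `|L (v w i) (v w i.+1) w|.
Proof. by move=> gw; rewrite /step indicE mem_set// mul1r. Qed.

Lemma step_ge0 i w : 0 <= step i w.
Proof. by rewrite mulr_ge0. Qed.

Lemma measurable_step i : (0 < i <= n.+1)%N -> measurable_fun setT (step i).
Proof.
move=> iN; rewrite stepE//; apply: measurable_sum => s.
apply: measurable_funM; last by apply: measurableT_comp.
apply: measurable_indic; apply: measurableI.
  exact: measurable_generic.
exact: measurable_path_event.
Qed.

(* The edges at the cities visited before the current city [head ord0 s]. They
   determine whether [s] is the history of the tour, and none of them joins
   [head ord0 s] to an unvisited city. *)
Definition left_edges (s : seq V) : set (V * V) :=
  [set e | exists x y, [/\ x \in behead s, y != x & e = edge x y]].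

Lemma left_edges_sub s : left_edges s `<=` all_edges (n := n).
Proof. by move=> _ [x [y [_ yx ->]]]; apply: edge_lt; rewrite eq_sym. Qed.

Local Open Scope ereal_scope.

(** [A] is any event that, once the history [s] is known, is determined by the edges in
    [left_edges s]. On each history the step exceeds [t] when a fresh star of [n.+1 - i] edges does,
    with a probability that does not depend on [s]. Taking [A] full gives the law of the step;
    taking for [A] a tail event of an earlier step gives independence. *)
Lemma step_tail i (t : R) A (G : i.-tuple V -> set Omega) :
    (0 < i <= n)%N -> (0 <= t)%R -> measurable A ->
    (forall s : i.-tuple V, start_path s -> sigma_of X (left_edges s) (G s) /\
        A `&` generic `&` path_event s = G s `&` generic) ->
  P (A `&` [set w | t < step i w]%R) = P A * (tail t ^+ (n.+1 - i))%:E.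
Proof.
move=> /andP[i0 iN] t0 mA AG.
have iN1 : (0 < i <= n.+1)%N by rewrite i0 ltnW.
have mstep : measurable [set w | t < step i w]%R.
  rewrite (_ : [set _ | _] = step i @^-1` `]t, +oo[); last first.
    by apply/seteqP; split => w /=; rewrite in_itv/= andbT.
  by rewrite -[X in measurable X]setTI; exact: measurable_step.
rewrite (path_partition mA iN1) ge0_sume_distrl//.
rewrite (path_partition (measurableI _ _ mA mstep) iN1).
apply: eq_bigr => s _.
have [sp|/negbTE sp] := boolP (start_path s); last first.
  rewrite (_ : path_event s = set0) ?setI0 ?measure0 ?mul0e//.
  by apply/seteqP; split => w //; rewrite /path_event/= sp.
have [sG AE] := AG s sp.
have mG := measurable_sigma_of sG.
rewrite AE (measureI_generic L_iid F_nneg F_atomless)//.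
have us : uniq s by case/andP: sp.
have hds : head ord0 s \in tval s.
  by case: (tval s) (size_tuple s) => [/= E|/= x s' _]; [rewrite -E in i0|exact: mem_head].
have beh x : x \in behead s -> x \in tval s /\ x != head ord0 s.
  case: (tval s) us => //= y s' /andP[ys' _] xs'; split; first by rewrite inE xs' orbT.
  by apply: contraNneq ys' => <-.
have := star_indep L_iid (x := head ord0 s) (S := [set y | y \notin tval s]%SET)
  (B := [set x : R | t < `|x|]%R) (@left_edges_sub s) _ (measurable_abs_gt t) sG.
have -> : #|[set y | y \notin tval s]%SET| = (n.+1 - i)%N.
  rewrite cardsCs card_ord; congr (_ - _)%N.
  rewrite -[RHS](size_tuple s) -(card_uniqP us) -cardsE.
  by apply: eq_card => y; rewrite !inE negbK.
move=> <-; last first.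
  move=> y; rewrite inE => ys; split; first by apply: contraNneq ys => ->.
  move=> [x [z [/beh [xs xh] zx]]] /edge_inj[[E _]|[_ E]]; first by rewrite E eqxx in xh.
  by rewrite E xs in ys.
have mstar : measurable [set w | forall y, y \in [set y | y \notin tval s]%SET ->
    [set x : R | t < `|x|]%R (L (head ord0 s) y w)].
  rewrite (_ : [set _ | _] =
      \bigcap_(y in [set y | y \in [set y | y \notin tval s]%SET])
        (L (head ord0 s) y @^-1` [set x : R | t < `|x|]%R)).
    apply: fin_bigcap_measurable => [|y _]; first exact: finite_finset.
    rewrite -[X in measurable X]setTI; apply: measurable_funPT => //.
    exact: measurable_abs_gt.
  by apply/seteqP; split => w h y; exact: h.
rewrite -[RHS](measureI_generic L_iid F_nneg F_atomless); last exact: measurableI.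
congr (P _).
rewrite (_ : A `&` _ `&` _ `&` _ =
    A `&` generic `&` path_event s `&` [set w | t < step i w]%R); last first.
  by apply/seteqP; split => w [[[]]].
rewrite AE [RHS]setIAC.
have Gp w : G s w -> generic w -> path_event s w.
  by move=> Gw gw; have [] : (A `&` generic `&` path_event s) w by rewrite AE.
apply/seteqP; split => w [[Gw gw] h]; split => //.
  move: h; rewrite /= /step indicE mem_set// mul1r => h y; rewrite inE => ys.
  have [gw1 gw2] := gw.
  have /(path_eventP _ gw iN1) E := Gp _ Gw gw.
  rewrite ger0_norm in h; last first.
    apply: gw1; apply/negP => /eqP E2.
    have := uniq_trace (v_NN w) (i := i.+1) iN.
    rewrite /= -E => /andP[/negP h' _]; apply: h'.
    by rewrite E -E2; case: (i) i0 => //= j _; rewrite mem_head.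
  rewrite (step_ltP (v_NN w))// in h; last by rewrite i0 iN.
  move/forallP : h => /(_ y) /implyP; rewrite -E => /(_ ys) h.
  by rewrite /= (lt_le_trans h)// ler_norm.
have /(path_eventP _ gw iN1) E := Gp _ Gw gw.
rewrite /= /step indicE mem_set// mul1r.
apply: lt_le_trans (ler_norm _).
rewrite (step_ltP (v_NN w))//; last by rewrite i0 iN.
apply/forallP => y; apply/implyP; rewrite -E => ys.
have := h y; rewrite inE => /(_ ys) /=; rewrite ger0_norm//.
have [gw1 gw2] := gw; apply: gw1.
by apply: contraNneq ys => <-.
Qed.

End steps.

Section step_law.
Context (R : realType) (F : probability (measurableTypeR R) R)
  d (Omega : measurableType d) (P : probability Omega R) (n : nat).
Local Notation V := 'I_n.+1.
Variable L : V -> V -> {RV P >-> R}.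
Hypothesis L_iid : iid_distances F L.
Hypothesis F_nneg : supported_nneg F.
Hypothesis F_atomless : forall x : R, F [set x] = 0%E.
Variable v : Omega -> nat -> V.
Hypothesis v_NN : forall w, is_NN_tour (fun i j => L i j w) ord0 (v w).

Local Notation l w := (fun i j => L i j w).
Local Notation X := (fun ij : V * V => L ij.1 ij.2).
Local Notation generic := (generic L).
Local Notation step := (step L v).
Local Notation tail := (tail F).
Local Open Scope ereal_scope.

Let NN : (0 < n.+1 <= n.+1)%N. Proof. exact: leqnn. Qed.

Lemma measurable_step_gt i (t : R) : (0 < i <= n.+1)%N ->
  measurable [set w | t < step i w]%R.
Proof.
move=> iN; rewrite (_ : [set _ | _] = step i @^-1` `]t, +oo[).
  rewrite -[X in measurable X]setTI; apply: (measurable_step L_iid v_NN iN) => //.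
by apply/seteqP; split => w /=; rewrite in_itv/= andbT.
Qed.

Lemma measurable_L_gt i j (t : R) : measurable [set w | t < `|L i j w|]%R.
Proof.
rewrite (_ : [set _ | _] = L i j @^-1` [set x : R | t < `|x|]%R)//.
rewrite -[X in measurable X]setTI; apply: measurable_funPT => //.
exact: measurable_abs_gt.
Qed.

Lemma sigma_of_left_hist (s : seq V) : uniq s ->
  sigma_of X (left_edges s) [set w | hist (fun _ _ => true) (l w) s].
Proof.
by move=> us; apply: (sigma_of_hist L_iid) => // x y xs yx _; exists x, y.
Qed.

Lemma step_law i (t : R) : (0 < i <= n)%N -> (0 <= t)%R ->
  P [set w | t < step i w]%R = (tail t ^+ (n.+1 - i))%:E.
Proof.
move=> iN t0.
have := @step_tail _ _ _ _ _ _ _ L_iid F_nneg F_atomless _ v_NN i t setT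
  (fun s => [set w | hist (fun _ _ => true) (l w) s]) iN t0 measurableT.
move=> h; rewrite -[[set _ | _]]setTI h ?probability_setT ?mul1e// => {h} s sp.
split; first by apply: sigma_of_left_hist; case/andP: sp.
rewrite setTI setIC; congr (_ `&` _).
by apply/seteqP; split => w; rewrite /path_event/= sp.
Qed.

Lemma step_indep i j (r t : R) : (0 < j < i)%N -> (i <= n)%N ->
    (0 <= r)%R -> (0 <= t)%R ->
  P ([set w | r < step j w]%R `&` [set w | t < step i w]%R) =
  P [set w | r < step j w]%R * P [set w | t < step i w]%R.
Proof.
move=> /andP[j0 ji] iN r0 t0.
have i0 : (0 < i)%N by rewrite (leq_trans _ ji).
rewrite (step_law _ t0) ?i0//.
have jN : (0 < j <= n.+1)%N by rewrite j0 (leq_trans (ltnW ji))// ltnW.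
(* In a history of length [i], latest city first, the cities [v j] and [v j.+1] have positions
   [i - j] and [(i - j).-1]. The former is not the current city, so the edge of step [j] is in
   [left_edges s]. *)
apply: (@step_tail _ _ _ _ _ _ _ L_iid F_nneg F_atomless _ v_NN i t _
  (fun s => [set w | hist (fun _ _ => true) (l w) s] `&`
     [set w | r < `|L (nth ord0 s (i - j)) (nth ord0 s (i - j).-1) w|]%R)) => //.
- by rewrite i0.
- exact: measurable_step_gt.
move=> s sp; have us : uniq s by case/andP: sp.
have [k kE] : exists k, (i - j = k.+1)%N by exists (i - j).-1; rewrite prednK// subn_gt0.
have ki : (k.+1 < i)%N by rewrite -kE ltn_subrL j0.
split.
  apply: (@measurableI _ (g_sigma_algebraType (cylinder X (left_edges s)))).
    exact: sigma_of_left_hist.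
  have ab : (nth ord0 s (i - j)) \in behead s.
    by rewrite kE -nth_behead mem_nth// size_behead size_tuple -ltnS prednK.
  set a := nth _ _ _ in ab *; set b := nth _ _ _.
  rewrite (_ : [set _ | _] = X (edge a b) @^-1` [set x : R | r < `|x|]%R).
    apply: sigma_of_preimage; last exact: measurable_abs_gt.
    exists a, b; split => //; rewrite /a /b kE/=.
    by rewrite nth_uniq// ?size_tuple// ?(ltn_trans _ ki)// ltn_eqF.
  by apply/seteqP; split => w /=; rewrite (L_edge L_iid).
have key w : generic w -> path_event L s w ->
    step j w = `|L (nth ord0 s (i - j)) (nth ord0 s (i - j).-1) w|%R.
  move=> gw pw; rewrite step_generic//.
  have /(path_eventP v_NN _ gw) -> := pw; last by rewrite i0 ltnW.
  rewrite kE nth_trace// nth_trace ?(ltnW ki)//=.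
  rewrite -kE subKn; last exact: ltnW.
  by have -> : (i - k = j.+1)%N by move: kE ji; lia.
apply/seteqP; split => w.
  move=> [[/= rw gw] pw]; split => //.
  split => /=; first by move: pw; rewrite /path_event /= sp.
  by rewrite -key.
move=> [[/= hw rw] gw].
have pw : path_event L s w by rewrite /path_event /= sp.
by split => //; split => //=; rewrite key.
Qed.

End step_law.

(** * The closing edge *)

Section last_edge.
Context (R : realType) (F : probability (measurableTypeR R) R)
  d (Omega : measurableType d) (P : probability Omega R) (n : nat).
Local Notation V := 'I_n.+1.
Variable L : V -> V -> {RV P >-> R}.
Hypothesis L_iid : iid_distances F L.
Hypothesis F_nneg : supported_nneg F.
Hypothesis F_atomless : forall x : R, F [set x] = 0%E.
Variable v : Omega -> nat -> V.
Hypothesis v_NN : forall w, is_NN_tour (fun i j => L i j w) ord0 (v w).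

Local Notation l w := (fun i j => L i j w).
Local Notation X := (fun ij : V * V => L ij.1 ij.2).
Local Notation generic := (generic L).
Local Notation step := (step L v).
Local Notation tail := (tail F).
Local Open Scope ereal_scope.

Let NN : (0 < n.+1 <= n.+1)%N. Proof. exact: leqnn. Qed.

Lemma last_city_neq w : (0 < n)%N -> v w n.+1 != ord0.
Proof.
move=> n0; have := uniq_trace (v_NN w) (leqnn _) => /= /andP[+ _].
have lastin (s : seq V) : (0 < size s)%N -> last ord0 s \in s.
  by case: s => //= x s _; exact: mem_last.
by apply: contraNneq => ->; rewrite -{1}(last_trace (v_NN w) n0) lastin// size_trace.
Qed.

Lemma last_stepE w : generic w -> step n.+1 w = `|L ord0 (v w n.+1) w|%R.
Proof.
move=> gw; rewrite step_generic//; have [_ _ ->] := v_NN w.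
by case: L_iid => ->.
Qed.

Lemma L_tail i j t : i != j -> P [set w | t < `|L i j w|]%R = (tail t)%:E.
Proof.
move=> ij; rewrite tailE -(L_law L_iid ij)//; exact: measurable_abs_gt.
Qed.

(** Union bound over the last city. The factor [n] is harmless here, as the bound only serves to
    show that the length is square integrable for each [n]. *)
Lemma last_tail_crude (t : R) : (0 < n)%N -> (0 <= t)%R ->
  P [set w | t < step n.+1 w]%R <= (n%:R * tail t)%:E.
Proof.
move=> n0 t0; have mA := measurable_step_gt L_iid v_NN t NN.
rewrite -(measureI_generic L_iid F_nneg F_atomless)//.
have mg := measurable_generic L.
pose Z (u : V) := [set w | u != ord0 /\ (t < `|L ord0 u w|)%R].
have ZE u : u != ord0 -> Z u = [set w | t < `|L ord0 u w|]%R.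
  by move=> u0; apply/seteqP; split => w; rewrite /Z/= u0; [case|split].
have Z0 : Z ord0 = set0 by apply/seteqP; split => w // -[]; rewrite eqxx.
have mZ u : measurable (Z u).
  by have [->|u0] := eqVneq u ord0; rewrite ?Z0// ZE//; exact: measurable_L_gt.
apply: le_trans (measure_fin_le P mZ _ _) _; first exact: measurableI.
  move=> w [/= h gw]; exists (v w n.+1) => //; split; first exact: last_city_neq.
  by rewrite -last_stepE.
rewrite big_ord_recl Z0 measure0 add0e.
rewrite (eq_bigr (fun=> (tail t)%:E)) => [|i _]; last by rewrite ZE//; exact: L_tail.
by rewrite sumEFin sumr_const card_ord mulr_natl.
Qed.

Definition star_ge (m : R) (u : V) : set Omega :=
  [set w | forall b, b \in ~: [set ord0; u]%SET -> [set x : R | m < `|x|]%R (L ord0 b w)].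

Lemma star_geE m u : star_ge m u =
  \bigcap_(b in [set b | b \in ~: [set ord0; u]%SET])
    (X (edge ord0 b) @^-1` [set x : R | m < `|x|]%R).
Proof.
by apply/seteqP; split => w h b hb; have := h b hb; rewrite /= (L_edge L_iid).
Qed.

Lemma star_ge_prob m t u : u != ord0 ->
  P (star_ge m u `&` [set w | t < `|L ord0 u w|]%R) = (tail m ^+ n.-1 * tail t)%:E.
Proof.
move=> u0.
have nu b : b \in ~: [set ord0; u]%SET -> b != ord0 /\ b != u.
  by rewrite !inE negb_or => /andP[].
pose D : set (V * V) := [set e | exists2 b, b \in ~: [set ord0; u]%SET & e = edge ord0 b].
have DE : D `<=` all_edges (n := n).
  by move=> _ [b /nu[b0 _] ->]; apply: edge_lt; rewrite eq_sym.
have sG : sigma_of X D (star_ge m u).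
  rewrite star_geE; apply: (@fin_bigcap_measurable _ (g_sigma_algebraType (cylinder X D))).
    exact: finite_finset.
  move=> b /= hb; apply: sigma_of_preimage; last exact: measurable_abs_gt.
  by exists b.
have := star_indep L_iid (x := ord0) (S := [set u]%SET) DE _ (measurable_abs_gt t) sG.
rewrite (_ : [set w | forall y, y \in [set u]%SET -> _] =
    [set w | t < `|L ord0 u w|]%R); last first.
  apply/seteqP; split => w /= h; first by apply: h; rewrite inE.
  by move=> y; rewrite inE => /eqP ->.
move=> ->; last first.
  move=> y; rewrite inE => /eqP ->; split => // -[b /nu[b0 bu]] /edge_inj[[_ E]|[E _]].
    by rewrite E eqxx in bu.
  by rewrite -E eqxx in b0.
rewrite cards1 expr1 EFinM; congr (_ * _).
have := star_indep L_iid (x := ord0) (S := ~: [set ord0; u]%SET) (D := set0)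
  (G := setT) _ _ (measurable_abs_gt m) _.
rewrite setTI probability_setT mul1e cardsCs finset.setCK cards2 card_ord.
rewrite eq_sym u0 subSS subn1 => -> //.
- by move=> b /nu[b0 _]; split.
- exact: (@measurableT _ (g_sigma_algebraType (cylinder X set0))).
Qed.

(** If the first step exceeds [m], so do all distances from [ord0]. The union bound over the last
    city [u] costs a factor [n], against [n.-1] independent factors [tail m] from the other
    edges. *)
Lemma last_tail_far (m t : R) : (0 < n)%N -> (0 <= t)%R ->
  P ([set w | t < step n.+1 w]%R `&` [set w | m < step 1 w]%R)
    <= (n%:R * tail m ^+ n.-1 * tail t)%:E.
Proof.
move=> n0 t0; have mA := measurable_step_gt L_iid v_NN t NN.
have mB := measurable_step_gt L_iid v_NN m (i := 1%N) isT.
rewrite -(measureI_generic L_iid F_nneg F_atomless); last exact: measurableI.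
have mg := measurable_generic L.
pose Z (u : V) := if u != ord0
  then star_ge m u `&` [set w | t < `|L ord0 u w|]%R else set0.
have mZ u : measurable (Z u).
  rewrite /Z; case: ifP => // _; apply: measurableI; last exact: measurable_L_gt.
  rewrite star_geE; apply: fin_bigcap_measurable; first exact: finite_finset.
  move=> b _; rewrite -[X in measurable X]setTI; apply: measurable_funPT => //.
  exact: measurable_abs_gt.
apply: le_trans (measure_fin_le P mZ _ _) _.
- by do 2 apply: measurableI => //.
- move=> w [[/= hN h1] gw]; exists (v w n.+1) => //; rewrite /Z last_city_neq//.
  split; last by rewrite /= -last_stepE.
  move=> b; rewrite !inE negb_or => /andP[b0 _] /=.
  have [gw1 _] := gw.
  apply: lt_le_trans (ler_norm _).
  move: h1; rewrite step_generic// ger0_norm; last first.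
    apply: gw1; apply/negP => /eqP E.
    by have := uniq_trace (v_NN w) (i := 2) n0; rewrite /= inE E eqxx.
  rewrite (step_ltP (v_NN w))// => /forallP/(_ b)/implyP.
  rewrite /=; have [-> _ _] := v_NN w.
  by rewrite /= inE b0 => /(_ isT).
rewrite big_ord_recl {1}/Z eqxx measure0 add0e.
rewrite (eq_bigr (fun=> (tail m ^+ n.-1 * tail t)%:E)) => [|i _]; last first.
  by rewrite /Z/=; exact: star_ge_prob.
by rewrite sumEFin sumr_const card_ord -mulrA mulr_natl.
Qed.

(* Let [u] be the last city and [a] the second one. If [L ord0 a <= m], then the
   whole history but the comparison of [L ord0 a] with [L ord0 u] is independent
   of [L ord0 u], and that comparison holds as soon as [L ord0 u > m]: this bounds
   the sum over all histories by [tail t / tail m]. *)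
Lemma last_tail_near (m t : R) : (1 < n)%N -> (0 <= t)%R -> (0 < tail m)%R ->
  P ([set w | t < step n.+1 w]%R `\` [set w | m < step 1 w]%R)
    <= (tail t / tail m)%:E.
Proof.
move=> n1 t0 qm; have mA := measurable_step_gt L_iid v_NN t NN.
have mB := measurable_step_gt L_iid v_NN m (i := 1%N) isT.
have mg := measurable_generic L.
rewrite (path_partition L_iid F_nneg F_atomless v_NN (measurableD mA mB) NN).
apply: (@le_trans _ _ (\sum_(s : n.+1.-tuple V)
    P (setT `&` generic `&` path_event L s) * (tail t / tail m)%:E)); last first.
  rewrite -ge0_sume_distrl// -(path_partition L_iid F_nneg F_atomless v_NN _ NN)//.
  by rewrite probability_setT mul1e.
apply: lee_sum => s _; have mps := measurable_path_event L_iid s.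
have [sp|/negbTE sp] := boolP (start_path s); last first.
  rewrite [X in P X <= _](_ : _ = set0).
    by rewrite measure0 mule_ge0// lee_fin divr_ge0 ?tail_ge0.
  by apply/seteqP; split => w //= [_]; rewrite /path_event/= sp.
have /andP[us /eqP lasts] := sp.
set u := head ord0 s; set a := nth u s (size s).-2.
have su : uniq s by [].
have sz : size s = n.+1 by rewrite size_tuple.
have u0E : u = nth u s 0 by rewrite /u; case: (tval s) sz.
have au : a != u.
  by rewrite /a {2}u0E nth_uniq// sz//=; case: n n1 => // -[].
have sE : tval s = u :: behead s by rewrite /u; case: (tval s) sz.
have lastE : ord0 = nth u s n.
  have := nth_last u s; rewrite sz /= => ->.
  by rewrite -[LHS]lasts sE.
have a0 : a != ord0.
  rewrite lastE /a nth_uniq// sz//; last by rewrite ltnS leq_pred.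
  by rewrite /= ltn_eqF// prednK// ltnW.
have u0 : u != ord0.
  by rewrite lastE {1}u0E nth_uniq ?sz// eq_sym -lt0n ltnW.
pose Q : set Omega := [set w | hist (skip u) (l w) s] `&`
  (L ord0 a @^-1` [set x : R | `|x| <= m]%R).
pose D : set (V * V) := [set e | all_edges e /\ e <> edge ord0 u].
have sQ : sigma_of X D Q.
  apply: (@measurableI _ (g_sigma_algebraType (cylinder X D))).
    apply: (sigma_of_hist L_iid) => // x y xs yx sxy.
    split; first by apply: edge_lt; rewrite eq_sym.
    move=> /edge_inj[[xE yE]|[xE _]]; first by rewrite /skip xE yE !eqxx in sxy.
    by move: us; rewrite sE /= -xE xs.
  rewrite -(L_edge_preimage L_iid); apply: sigma_of_preimage.
    split; first by apply: edge_lt; rewrite eq_sym.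
    by move=> /edge_inj[[_ E]|[E _]]; [rewrite E eqxx in au|rewrite -E eqxx in u0].
  rewrite (_ : [set _ | _] = ~` [set x : R | m < `|x|]%R).
    by apply: measurableC; exact: measurable_abs_gt.
  by apply/seteqP; split => x /=; rewrite leNgt => /negP.
have mQ := measurable_sigma_of sQ.
have starQ r : P (Q `&` [set w | r < `|L ord0 u w|]%R) = P Q * (tail r)%:E.
  have := star_indep L_iid (x := ord0) (S := [set u]%SET) _ _ (measurable_abs_gt r) sQ.
  rewrite (_ : [set w | forall y, y \in [set u]%SET -> _] =
      [set w | r < `|L ord0 u w|]%R); last first.
    apply/seteqP; split => w /= h; first by apply: h; rewrite inE.
    by move=> y; rewrite inE => /eqP ->.
  move=> ->; rewrite ?cards1 ?expr1//; first by move=> e [].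
  by move=> y; rewrite inE => /eqP ->; split => // -[].
have cities w : generic w -> path_event L s w -> v w n.+1 = u /\ v w 2 = a.
  move=> gw /(path_eventP v_NN _ gw NN) E; split; first by rewrite /u E.
  have aE : a = nth ord0 s n.-1.
    by rewrite /a (set_nth_default ord0) sz// ltnS leq_pred.
  rewrite aE [X in nth _ X _](_ : _ = trace (v w) n.+1)// nth_trace ?ltnS ?leq_pred//.
  by have -> : (n.+1 - n.-1 = 2)%N by move: n1; lia.
apply: (@le_trans _ _ (P Q * (tail t)%:E)).
  rewrite -starQ; apply: le_measure; rewrite ?inE.
  - by apply: measurableI => //; apply: measurableI => //; exact: measurableD.
  - by apply: measurableI => //; exact: measurable_L_gt.
  move=> w [[[/= hN /negP h1] gw] pw]; have [vN v2] := cities w gw pw.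
  split; last by rewrite /= -vN -last_stepE.
  split.
    by apply: hist_skip => //; move: pw; rewrite /path_event/= sp.
  rewrite /= leNgt; apply: contra h1; rewrite step_generic// v2.
  by have [-> _ _] := v_NN w.
(* The factor [tail m] is the probability that the edge from [ord0] to [u] exceeds [m]. This event
   is independent of [Q] and restores the skipped comparison, so that [P Q * tail m] is at most the
   probability of the history [s]. *)
have -> : (tail t)%:E = (tail m)%:E * (tail t / tail m)%:E.
  by rewrite -EFinM mulrC divfK// gt_eqF.
rewrite muleA; apply: lee_wpmul2r; first by rewrite lee_fin divr_ge0 ?tail_ge0.
rewrite -starQ -(measureI_generic L_iid F_nneg F_atomless); last first.
  by apply: measurableI => //; exact: measurable_L_gt.
apply: le_measure; rewrite ?inE.
- by apply: measurableI => //; apply: measurableI => //; exact: measurable_L_gt.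
- by do 2 apply: measurableI => //.
move=> w [[[/= hq ha] hu] gw]; split; first by split.
rewrite /path_event /= sp; apply: (hist_unskip (u := u)) => //.
have [gw1 _] := gw.
rewrite -[X in (X < _)%R]ger0_norm; last by apply: gw1; rewrite eq_sym.
rewrite -[X in (_ < X)%R]ger0_norm; last by apply: gw1; rewrite eq_sym.
exact: le_lt_trans hu.
Qed.

Lemma last_tail (m t : R) : (1 < n)%N -> (0 <= t)%R -> (0 < tail m)%R ->
  P [set w | t < step n.+1 w]%R
    <= ((n%:R * tail m ^+ n.-1 + (tail m)^-1) * tail t)%:E.
Proof.
move=> n1 t0 qm; have mA := measurable_step_gt L_iid v_NN t NN.
have mB := measurable_step_gt L_iid v_NN m (i := 1%N) isT.
rewrite (measureDI P mA mB).
rewrite mulrDl EFinD [leLHS]addeC; apply: leeD.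
  by apply: last_tail_far => //; exact: ltnW.
have -> : ((tail m)^-1 * tail t = tail t / tail m)%R by rewrite mulrC.
exact: last_tail_near.
Qed.

End last_edge.

(** * Moments of the steps *)

Section moments.
Context (R : realType) (F : probability (measurableTypeR R) R).
Local Open Scope ereal_scope.

(* The mean of the minimum of [k] independent distances. *)
Definition min_mean (k : nat) : \bar R :=
  \int[@lebesgue_measure R]_(r in `[0%R, +oo[) (tail F r ^+ k)%:E.

Definition second_moment : \bar R := \int[F]_x (x ^+ 2)%:E.

Lemma le_tail (s t : R) : (s <= t)%R -> (tail F t <= tail F s)%R.
Proof.
move=> st; rewrite -lee_fin !tailE; apply: le_measure; rewrite ?inE.
- exact: measurable_abs_gt.
- exact: measurable_abs_gt.
- by move=> x /=; exact: le_lt_trans.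
Qed.

Context d (Omega : measurableType d) (P : probability Omega R) (n : nat).
Local Notation V := 'I_n.+1.
Variable L : V -> V -> {RV P >-> R}.
Hypothesis L_iid : iid_distances F L.
Hypothesis F_nneg : supported_nneg F.
Hypothesis F_atomless : forall x : R, F [set x] = 0%E.
Variable v : Omega -> nat -> V.
Hypothesis v_NN : forall w, is_NN_tour (fun i j => L i j w) ord0 (v w).

Local Notation step := (step L v).

Lemma tour_length_steps w : generic L w -> (0 < n)%N ->
  tour_length (fun i j => L i j w) (v w) = (\sum_(1 <= i < n.+2) step i w)%R.
Proof.
move=> gw n0; rewrite /tour_length; apply: eq_big_nat => i /andP[i0 iN].
rewrite step_generic// ger0_norm//; have [gw1 _] := gw; apply: gw1.
move: iN; rewrite ltnS leq_eqVlt => /orP[/eqP ->|iN].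
  have [_ _ ->] := v_NN w; exact: (last_city_neq v_NN _ n0).
have := uniq_trace (v_NN w) iN; case: i i0 iN => // i _ iN /= /andP[+ _].
by rewrite inE negb_or eq_sym => /andP[].
Qed.

Let rng i : (0 < i <= n)%N -> (0 < i <= n.+1)%N.
Proof. by move=> /andP[-> /= /leqW]. Qed.

Lemma step_preimage i (t : R) : step i @^-1` `]t, +oo[ = [set w | t < step i w]%R.
Proof. by apply/seteqP; split => w /=; rewrite in_itv/= andbT. Qed.

Lemma expectation_step i : (0 < i <= n)%N ->
  \int[P]_w (step i w)%:E = min_mean (n.+1 - i).
Proof.
move=> iN; have mi := measurable_step L_iid v_NN (rng iN).
under eq_integral do rewrite -[step i _]mul1r.
rewrite (@ge0_layer_cake _ _ _ P (cst 1%R))//; last by move=> w; exact: step_ge0.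
apply: eq_integral => t; rewrite inE/= in_itv/= andbT => t0.
rewrite -(step_law L_iid F_nneg F_atomless v_NN iN t0).
under eq_integral do rewrite mul1r.
rewrite step_preimage integral_indic ?setIT//.
exact: (measurable_step_gt L_iid v_NN _ (rng iN)).
Qed.

Lemma expectation_step_prod i j : (0 < j < i)%N -> (i <= n)%N ->
  \int[P]_w (step j w * step i w)%:E = min_mean (n.+1 - j) * min_mean (n.+1 - i).
Proof.
move=> /[dup] ji' /andP[j0 ji] iN.
have jN : (0 < j <= n)%N by rewrite j0 (leq_trans (ltnW ji)).
have iN' : (0 < i <= n)%N by rewrite iN (leq_trans _ ji).
rewrite ge0_expectation_prod.
- by rewrite !expectation_step.
- exact: (measurable_step L_iid v_NN (rng jN)).
- exact: (measurable_step L_iid v_NN (rng iN')).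
- by move=> w; exact: step_ge0.
- by move=> w; exact: step_ge0.
- move=> r t r0 t0; rewrite !step_preimage.
  exact: (step_indep L_iid F_nneg F_atomless v_NN ji' iN r0 t0).
Qed.

(** A step below [dl] has its square bounded by [dl] times itself; the part above [dl] is compared
    with [F] through its tail. After summation over [i] the first terms give a multiple of the mean
    and the second ones a geometric sum. *)
Lemma expectation_step_sqr i (dl : R) : (0 < i <= n)%N -> (0 <= dl)%R ->
  \int[P]_w (step i w ^+ 2)%:E <=
    dl%:E * min_mean (n.+1 - i) + (tail F dl ^+ (n - i))%:E * second_moment.
Proof.
move=> iN dl0; have mi := measurable_step L_iid v_NN (rng iN).
pose Y w := (step i w * \1_[set w | dl < step i w]%R w)%R.
have mY : measurable_fun setT Y.
  apply: measurable_funM => //; apply: measurable_indic.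
  exact: (measurable_step_gt L_iid v_NN _ (rng iN)).
apply: (@le_trans _ _ (\int[P]_w (dl%:E * (step i w)%:E + (Y w ^+ 2)%:E))).
  apply: ge0_le_integral => //.
  - by move=> w _; rewrite lee_fin sqr_ge0.
  - by apply/measurable_EFinP; exact: measurable_funX.
  - apply: emeasurable_funD; first by apply: measurable_funeM; exact/measurable_EFinP.
    by apply/measurable_EFinP; exact: measurable_funX.
  move=> w _; rewrite -EFinM -EFinD lee_fin /Y indicE.
  have s0 := step_ge0 L v i w.
  have [h|h] := ltP dl (step i w).
    by rewrite mem_set// mulr1 lerDr mulr_ge0.
  rewrite memNset; last by apply/negP; rewrite -leNgt.
  by rewrite mulr0 expr0n addr0 expr2 ler_wpM2r.
rewrite ge0_integralD//; last 4 first.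
- by move=> w _; rewrite mule_ge0// lee_fin; exact: step_ge0.
- by apply: measurable_funeM; exact/measurable_EFinP.
- by move=> w _; rewrite lee_fin sqr_ge0.
- by apply/measurable_EFinP; exact: measurable_funX.
rewrite ge0_integralZl//; last 2 first.
- exact/measurable_EFinP.
- by move=> w _; rewrite lee_fin; exact: step_ge0.
rewrite expectation_step//; apply: leeD => //.
apply: le_expectation_sqr => //; first by rewrite exprn_ge0// tail_ge0.
move=> t t0; rewrite -tailE -EFinM.
(* Of the [n.+1 - i] tail factors at [Num.max t dl], one is bounded by [tail F t] and the other
   [n - i] by [tail F dl]. *)
apply: (@le_trans _ _ (P [set w | Num.max t dl < step i w]%R)).
  apply: le_measure; rewrite ?inE.
  - rewrite (_ : [set _ | _] = Y @^-1` [set x : R | t < `|x|]%R)//.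
    by rewrite -[X in measurable X]setTI; apply: mY => //; exact: measurable_abs_gt.
  - exact: (measurable_step_gt L_iid v_NN _ (rng iN)).
  move=> w /=; rewrite /Y indicE; have [h|h] := ltP dl (step i w).
    by rewrite mem_set// mulr1 ger0_norm ?step_ge0// gt_max h andbT.
  rewrite memNset; last by apply/negP; rewrite -leNgt.
  by rewrite mulr0 normr0 ltNge t0.
rewrite (step_law L_iid F_nneg F_atomless v_NN iN) ?le_max ?t0// lee_fin.
have /andP[_ iN2] := iN; rewrite subSn// exprSr ler_pM ?exprn_ge0 ?tail_ge0//.
  by rewrite lerXn2r ?nnegrE ?tail_ge0// le_tail// le_max lexx orbT.
by rewrite le_tail// le_max lexx.
Qed.

Lemma expectation_last_sqr (m : R) : (1 < n)%N -> (0 < tail F m)%R ->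
  \int[P]_w (step n.+1 w ^+ 2)%:E <=
    (n%:R * tail F m ^+ n.-1 + (tail F m)^-1)%:E * second_moment.
Proof.
move=> n1 qm; apply: le_expectation_sqr => //.
- exact: (@measurable_step _ _ _ _ _ _ _ L_iid _ v_NN n.+1 (leqnn n.+1)).
- by rewrite addr_ge0// ?invr_ge0 ?mulr_ge0 ?exprn_ge0 ?tail_ge0.
move=> t t0; rewrite -tailE -EFinM.
under [X in P X]eq_set do rewrite ger0_norm ?step_ge0//.
exact: (last_tail L_iid F_nneg F_atomless v_NN n1 t0 qm).
Qed.

Lemma expectation_last_sqr_crude : (0 < n)%N ->
  \int[P]_w (step n.+1 w ^+ 2)%:E <= n%:R%:E * second_moment.
Proof.
move=> n0; apply: le_expectation_sqr => //.
- exact: (@measurable_step _ _ _ _ _ _ _ L_iid _ v_NN n.+1 (leqnn n.+1)).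
move=> t t0; rewrite -tailE -EFinM.
under [X in P X]eq_set do rewrite ger0_norm ?step_ge0//.
exact: (last_tail_crude L_iid F_nneg F_atomless v_NN n0 t0).
Qed.

End moments.

(** * Asymptotics of the expected steps *)

Section pow_integral.
Context (R : realType).
Local Notation mu := (@lebesgue_measure R).

Lemma is_derive_onemZX (a : R) (k : nat) (x : R) : a != 0 ->
  is_derive x (1 : R)
    ((- (a * k.+1%:R)^-1) *: ((cst 1 - a *: (id : R -> R)) ^+ k.+1))
    ((1 - a * x) ^+ k).
Proof.
move=> a0; apply: is_derive_eq; rewrite /GRing.scale /=.
rewrite (_ : (cst 1 - a \*: id) x = 1 - a * x)//.
have k0 : k.+1%:R != 0 :> R by rewrite pnatr_eq0.
move: (k.+1%:R : R) k0 => K K0; field.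
by rewrite K0.
Qed.

Lemma integral_onemZX (a dl : R) (k : nat) : 0 < a -> 0 < dl ->
  (\int[mu]_(t in `[0%R, dl]) ((1 - a * t) ^+ k)%:E =
    ((1 - (1 - a * dl) ^+ k.+1) / (a * k.+1%:R))%:E)%E.
Proof.
move=> a0 dl0; have an0 : a != 0 by rewrite gt_eqF.
set G := (- (a * k.+1%:R)^-1) *: ((cst 1 - a *: (id : R -> R)) ^+ k.+1).
have GE x : G x = - (a * k.+1%:R)^-1 * (1 - a * x) ^+ k.+1.
  by rewrite /G /= exprfctE.
have dG (x : R) : is_derive x (1 : R) G ((1 - a * x) ^+ k) by exact: is_derive_onemZX.
have cG (x : R) : {for x, continuous G}.
  by apply: differentiable_continuous; apply/derivable1_diffP; have [] := dG x.
rewrite (@continuous_FTC2 _ _ G)//.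
- rewrite !GE -EFinB; congr EFin; rewrite mulr0 subr0 expr1n.
  move: (_ * k.+1%:R)^-1 => c; ring.
- apply: continuous_subspaceT => x.
  apply: (@continuous_comp _ _ _ (fun t : R => 1 - a * t) (fun y => y ^+ k));
    last exact: exprn_continuous.
  by apply: cvgB; [exact: cvg_cst|apply: cvgM; [exact: cvg_cst|exact: cvg_id]].
- split.
  + by move=> x _; have [] := dG x.
  + exact: cvg_at_right_filter (cG 0).
  + exact: cvg_at_left_filter (cG dl).
- by move=> x _; rewrite derive1E; have [_ ->] := dG x.
Qed.

End pow_integral.

Section density.
Context (R : realType) (F : probability (measurableTypeR R) R) (f : R -> R).
Hypothesis F_nneg : supported_nneg F.
Hypothesis F_variance : finite_variance F.
Hypothesis F_density : is_density F f.
Hypothesis f_cvg0 : f t @[t --> 0^'+] --> f 0.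
Hypothesis f0_gt0 : 0 < f 0.
Local Notation mu := (@lebesgue_measure R).

Lemma density_atomless (x : R) : F [set x] = 0%E.
Proof. by case: F_density => _ _ ->//; rewrite integral_set1. Qed.

Lemma tail_itv (t : R) : 0 <= t -> tail F t = 1 - fine (F `[0%R, t]%classic).
Proof.
move=> t0; apply: EFin_inj; rewrite tailE EFinB.
have mI : measurable (`[0%R, t]%classic : set (measurableTypeR R)).
  exact: measurable_itv.
have mN : measurable ([set x : R | x < 0] : set (measurableTypeR R)).
  by rewrite -set_itvNyo; exact: measurable_itv.
rewrite fineK ?fin_num_measure// -probability_setC//.
have mT := measurable_abs_gt t.
apply/eqP; rewrite eq_le; apply/andP; split.
  apply: le_measure; rewrite ?inE//; first exact: measurableC.
  by move=> x /= tx; rewrite in_itv/= => /andP[x0 xt]; rewrite ger0_norm// ltNge xt in tx.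
apply: (@le_trans _ _ (F ([set x : R | t < `|x|] `|` [set x : R | x < 0]))).
  apply: le_measure; rewrite ?inE//; [exact: measurableC|exact: measurableU|].
  move=> x /=; rewrite in_itv/= => /negP; rewrite negb_and -!ltNge.
  move=> /orP[x0|tx]; first by right.
  by left; apply: lt_le_trans (ler_norm _).
by rewrite (@measureU0 _ _ _ F _ _ mT mN F_nneg).
Qed.

(** Linear bounds on a fixed interval are used instead of an o(t), because the powers of affine
    functions integrate explicitly. The right limit controls [f] on an open interval only; at 0 the
    bound is trivial, as the limit is [f 0] itself. *)
Lemma tail_bounds (e : R) : 0 < e -> exists2 dl : R, 0 < dl &
  forall t, 0 <= t <= dl -> 1 - (f 0 + e) * t <= tail F t <= 1 - (f 0 - e) * t.
Proof.
move=> e0; case: F_density => mf f_ge0 FE.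
have [r /= r0 fr] : exists2 r : R, 0 < r & forall x, 0 < x < r -> `|f 0 - f x| <= e.
  move/cvgrPdist_le : f_cvg0 => /(_ _ e0) [r /= r0 fr].
  exists r => // x /andP[x0 xr]; apply: fr => //=.
  by rewrite sub0r normrN gtr0_norm.
exists (r / 2); first by rewrite divr_gt0.
move=> t /andP[t0 tr].
have tr' : t < r by rewrite (le_lt_trans tr)// ltr_pdivrMr// ltr_pMr// ltr1n.
have fx x : x \in `[0%R, t] -> f 0 - e <= f x <= f 0 + e.
  rewrite in_itv/= => /andP[]; rewrite le_eqVlt => /orP[/eqP <- _|x0 xt].
    by rewrite lerBlDr lerDl ltW//= lerDl ltW.
  have := fr x; rewrite x0 (le_lt_trans xt tr') => /(_ isT).
  by rewrite ler_norml lerBrDr lerBlDr => /andP[h1 h2]; apply/andP; split; lra.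
have mI : measurable (`[0%R, t]%classic : set (measurableTypeR R)).
  exact: measurable_itv.
have intc (c : R) : (\int[mu]_(x in `[0%R, t]) c%:E = (c * t)%:E)%E.
  rewrite integral_cst//= lebesgue_measure_itv/= lte_fin EFinM.
  case: ltP => [_|t0']; first by rewrite sube0.
  by congr (_ * EFin _)%E; apply/eqP; rewrite eq_le t0 t0'.
have mfE : measurable_fun `[0%R, t] (EFin \o f).
  by apply/measurable_EFinP; exact: measurable_funTS.
have Fub : (F `[0%R, t]%classic <= ((f 0 + e) * t)%:E)%E.
  rewrite FE// -intc; apply: ge0_le_integral => //.
  - by move=> x _; rewrite lee_fin.
  - by move=> x xt; rewrite lee_fin; have /andP[] := fx x xt.
have Flb : (((f 0 - e) * t)%:E <= F `[0%R, t]%classic)%E.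
  have [ef|fe] := leP e (f 0); last first.
    apply: (@le_trans _ _ 0%E) => //; rewrite lee_fin; apply: mulr_le0_ge0 => //.
    by rewrite subr_le0 ltW.
  rewrite FE// -intc; apply: ge0_le_integral => //.
  - by move=> x _; rewrite lee_fin subr_ge0.
  - by move=> x xt; rewrite lee_fin; have /andP[] := fx x xt.
rewrite tail_itv//; move: Fub Flb.
rewrite -[F `[0%R, t]%classic]fineK ?fin_num_measure// !lee_fin => h1 h2.
by apply/andP; split; lra.
Qed.

End density.

Section min_mean_bounds.
Context (R : realType) (F : probability (measurableTypeR R) R).
Hypothesis F_variance : finite_variance F.
Local Notation mu := (@lebesgue_measure R).
Local Open Scope ereal_scope.

Lemma second_moment_fin : second_moment F \is a fin_num.
Proof.
rewrite ge0_fin_numE; last by apply: integral_ge0 => x _; rewrite lee_fin sqr_ge0.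
pose m := fine 'E_F[(fun x : R => x)].
have V : 'V_F[(fun x : R => x)] = \int[F]_x ((x - m) ^+ 2)%:E.
  rewrite /variance unlock -/m unlock; apply: eq_integral => x _.
  by rewrite expr2.
have mid : measurable_fun setT (fun x : measurableTypeR R => x) by exact: measurable_id.
have mV : measurable_fun setT (fun x : measurableTypeR R => ((x - m) ^+ 2)%:E).
  by apply/measurable_EFinP; apply: measurable_funX; apply: measurable_funB.
apply: (@le_lt_trans _ _ (\int[F]_x (2%:E * ((x - m) ^+ 2)%:E + (2 * m ^+ 2)%:E))).
  apply: ge0_le_integral => //.
  - by move=> x _; rewrite lee_fin sqr_ge0.
  - by apply/measurable_EFinP; apply: measurable_funX.
  - by apply: emeasurable_funD => //; apply: measurable_funeM.
  - move=> x _; rewrite -EFinM -EFinD lee_fin.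
    (* Indeed 2 (x - m)^2 + 2 m^2 - x^2 = (x - 2 m)^2. *)
    have := sqr_ge0 (x - 2 * m)%R; lra.
rewrite ge0_integralD//; last 3 first.
- by move=> x _; rewrite -EFinM lee_fin mulr_ge0// sqr_ge0.
- by apply: measurable_funeM.
- by move=> x _; rewrite lee_fin mulr_ge0// sqr_ge0.
rewrite ge0_integralZl//; last by move=> x _; rewrite lee_fin sqr_ge0.
rewrite -V integral_cst//= probability_setT mule1.
have := F_variance; rewrite /finite_variance => Vfin.
by rewrite -[X in 2%:E * X]fineK// -EFinM -EFinD ltry.
Qed.

Lemma min_mean_ge0 k : 0 <= min_mean F k.
Proof. by apply: integral_ge0 => t _; rewrite lee_fin exprn_ge0// tail_ge0. Qed.

Lemma min_mean1 : min_mean F 1 = \int[F]_x (`|x|%R)%:E.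
Proof.
under eq_integral => x _ do rewrite -(mul1r `|x|%R).
rewrite (@ge0_layer_cake _ _ _ F (cst 1%R) (fun x => `|x|%R))//.
  apply: eq_integral => t _; under [RHS]eq_integral do rewrite mul1r.
  rewrite expr1 tailE (_ : _ @^-1` _ = [set x : R | t < `|x|]%R).
    by rewrite integral_indic ?setIT//; exact: measurable_abs_gt.
  by apply/seteqP; split => x /=; rewrite in_itv/= andbT.
exact: (@normr_measurable R setT).
Qed.

Lemma min_mean1_fin : min_mean F 1 \is a fin_num.
Proof.
rewrite ge0_fin_numE ?min_mean_ge0// min_mean1.
have mid : measurable_fun setT (fun x : measurableTypeR R => x) by exact: measurable_id.
have mX2 : measurable_fun setT (fun x : measurableTypeR R => (x ^+ 2)%:E).
  by apply/measurable_EFinP; apply: measurable_funX.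
apply: (@le_lt_trans _ _ (\int[F]_x (1 + (x ^+ 2)%:E))).
  apply: ge0_le_integral => //.
  - by apply/measurable_EFinP; exact: (@normr_measurable R setT).
  - by apply: emeasurable_funD.
  - move=> x _; rewrite -EFinD lee_fin -[X in (_ + X)%R]real_normK ?num_real//.
    have := sqr_ge0 (`|x| - 1)%R; have := normr_ge0 x; nra.
rewrite ge0_integralD//; last by move=> x _; rewrite lee_fin sqr_ge0.
rewrite integral_cst//= probability_setT mule1 -/(second_moment F).
by rewrite -[second_moment F]fineK ?second_moment_fin// -EFinD ltry.
Qed.

Lemma measurable_tailX k : measurable_fun setT (fun t : R => (tail F t ^+ k)%:E).
Proof.
apply/measurable_EFinP; apply: measurable_funX.
apply: nonincreasing_measurable => // s t st; exact: le_tail.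
Qed.

(** On [0, dl] the integrand is at most (1 - a t)^(k+1), whose integral is at most 1 / (a (k+2)).
    Beyond [dl], all tail factors but one are bounded by [tail F dl], and the remaining one
    integrates to the finite first mean. *)
Lemma min_mean_le (a dl : R) k : (0 < a)%R -> (0 < dl)%R -> (a * dl <= 1)%R ->
    (forall t, (0 <= t <= dl)%R -> (tail F t <= 1 - a * t)%R) ->
  min_mean F k.+1 <=
    ((a * k.+2%:R)^-1 + tail F dl ^+ k * fine (min_mean F 1))%:E.
Proof.
move=> a0 dl0 adl tl.
pose A : set R := `[0%R, dl]%classic.
pose h := (fun t : R => ((1 - a * t) ^+ k.+1)%:E) \_ A.
have DA : (`[0%R, +oo[ : set R) `&` A = A.
  by apply: setIidr => x /=; rewrite !in_itv/= andbT => /andP[].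
have h0 t : 0 <= h t.
  rewrite /h patchE /A mem_setE in_itv/=; case: ifPn => // /andP[t0 tdl].
  rewrite lee_fin exprn_ge0// subr_ge0 (le_trans _ adl)//.
  by rewrite ler_pM2l.
have mh : measurable_fun (`[0%R, +oo[ : set R) h.
  apply/measurable_restrict => //; first exact: measurable_itv.
  apply: measurable_funTS; apply/measurable_EFinP.
  apply: measurable_funX; apply: measurable_funB => //; exact: measurable_funM.
have mt1 := measurable_tailX 1.
apply: (@le_trans _ _ (\int[mu]_(t in `[0%R, +oo[)
    (h t + (tail F dl ^+ k)%:E * (tail F t ^+ 1)%:E))).
  apply: ge0_le_integral => //.
  - by move=> t _; rewrite lee_fin exprn_ge0// tail_ge0.
  - by apply: measurable_funTS; exact: measurable_tailX.
  - apply: emeasurable_funD => //; apply: measurable_funTS.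
    exact: measurable_funeM.
  move=> t; rewrite /= in_itv/= andbT => t0; rewrite -EFinM expr1.
  have q0 := tail_ge0 F t; have qd := tail_ge0 F dl.
  rewrite /h patchE /A mem_setE in_itv/= t0/=; case: ifPn => tdl.
    rewrite -EFinD lee_fin -[leLHS]addr0 lerD ?mulr_ge0 ?exprn_ge0//.
    by rewrite lerXn2r ?nnegrE ?tl ?t0// (le_trans q0)// tl ?t0.
  rewrite add0e lee_fin exprSr ler_wpM2r// lerXn2r ?nnegrE//.
  by rewrite le_tail// ltW// ltNge.
rewrite ge0_integralD//; last 2 first.
- by move=> t _; rewrite -EFinM lee_fin mulr_ge0 ?exprn_ge0 ?tail_ge0.
- by apply: measurable_funTS; exact: measurable_funeM.
rewrite EFinD; apply: leeD.
  rewrite /h -integral_mkcondr DA integral_onemZX// lee_fin.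
  rewrite ler_pdivrMr ?mulr_gt0// mulVf ?gt_eqF ?mulr_gt0//.
  by rewrite gerBl exprn_ge0// subr_ge0.
rewrite ge0_integralZl//; last 3 first.
- by apply: measurable_funTS.
- by move=> t _; rewrite lee_fin exprn_ge0 ?tail_ge0.
- by rewrite lee_fin exprn_ge0 ?tail_ge0.
by rewrite EFinM fineK// min_mean1_fin.
Qed.

Lemma min_mean_ge (b dl : R) k : (0 < b)%R -> (0 < dl)%R -> (b * dl <= 1)%R ->
    (forall t, (0 <= t <= dl)%R -> (1 - b * t <= tail F t)%R) ->
  ((1 - (1 - b * dl) ^+ k.+2) / (b * k.+2%:R))%:E <= min_mean F k.+1.
Proof.
move=> b0 dl0 bdl tl; rewrite -integral_onemZX//.
apply: (@le_trans _ _ (\int[mu]_(t in `[0%R, dl]) (tail F t ^+ k.+1)%:E)).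
  have bt t : (t <= dl)%R -> (0 <= 1 - b * t)%R.
    by move=> tdl; rewrite subr_ge0 (le_trans _ bdl)// ler_pM2l.
  apply: ge0_le_integral => //.
  - by move=> t; rewrite /= in_itv/= => /andP[_ /bt ?]; rewrite lee_fin exprn_ge0.
  - apply: measurable_funTS; apply/measurable_EFinP.
    apply: measurable_funX; apply: measurable_funB => //; exact: measurable_funM.
  - by apply: measurable_funTS; exact: measurable_tailX.
  move=> t; rewrite /= in_itv/= => tdl; rewrite lee_fin lerXn2r ?nnegrE ?tail_ge0//.
    by apply: bt; case/andP: tdl.
  exact: tl.
apply: ge0_subset_integral => //.
- by apply: measurable_funTS; exact: measurable_tailX.
- by move=> t _; rewrite lee_fin exprn_ge0// tail_ge0.
- by move=> t /=; rewrite !in_itv/= andbT => /andP[].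
Qed.

Lemma min_mean_fin k : min_mean F k.+1 \is a fin_num.
Proof.
rewrite ge0_fin_numE ?min_mean_ge0//.
apply: (@le_lt_trans _ _ (min_mean F 1)); last first.
  by rewrite -ge0_fin_numE ?min_mean_ge0// min_mean1_fin.
apply: ge0_le_integral => //.
- by move=> t _; rewrite lee_fin exprn_ge0// tail_ge0.
- by apply: measurable_funTS; exact: measurable_tailX.
- by apply: measurable_funTS; exact: measurable_tailX.
move=> t _; rewrite lee_fin expr1 exprS ler_piMr ?tail_ge0// exprn_ile1 ?tail_ge0//.
rewrite -lee_fin tailE; apply: probability_le1; exact: measurable_abs_gt.
Qed.

End min_mean_bounds.

Lemma sum_subn_rev (V : nmodType) n (g : nat -> V) :
  \sum_(i < n) g (n - i)%N = \sum_(k < n) g k.+1.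
Proof.
rewrite (reindex_inj rev_ord_inj)/=; apply: eq_bigr => i _.
by congr g; rewrite subKn.
Qed.

Section real_sums.
Variable R : realType.

Lemma sum_inv_le_ln n : \sum_(k < n) (k.+2%:R : R)^-1 <= ln n.+1%:R.
Proof.
elim: n => [|n IH]; first by rewrite big_ord0 ln1.
rewrite big_ord_recr /= (le_trans (lerD IH (lexx _)))// -lerBrDl.
rewrite -ln_div ?posrE ?ltr0n// -lerN2 -lnV ?posrE ?divr_gt0// invf_div.
have -> : n.+1%:R / n.+2%:R = 1 + - (n.+2%:R)^-1 :> R.
  by rewrite -[X in X / _](addrK 1) natr1 mulrDl mulNr divff ?pnatr_eq0// mul1r.
by apply: le_ln1Dx; rewrite ltrN2 invf_lt1 ?ltr1n.
Qed.

Lemma sum_inv_ge_ln n : ln n.+1%:R - ln 2 <= \sum_(k < n) (k.+2%:R : R)^-1.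
Proof.
(* The induction needs this sharper bound, which telescopes through 1 / (k+2) >= ln ((k+3) /
   (k+2)). *)
apply: (@le_trans _ _ (ln n.+2%:R - ln 2)).
  by rewrite lerD2r ler_ln ?posrE// ler_nat.
elim: n => [|n IH]; first by rewrite big_ord0 subrr.
rewrite big_ord_recr /= (le_trans _ (lerD IH (lexx _)))//.
rewrite addrAC lerD2r -lerBlDl -ln_div ?posrE//.
have -> : n.+3%:R / n.+2%:R = 1 + (n.+2%:R)^-1 :> R.
  by rewrite -[n.+3]addn1 natrD mulrDl divff ?pnatr_eq0// mul1r.
by apply: le_ln1Dx; rewrite (lt_trans (ltrN10 _))// invr_gt0.
Qed.

Lemma sum_geometric_le (x : R) n : 0 <= x < 1 -> \sum_(k < n) x ^+ k <= (1 - x)^-1.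
Proof.
move=> /andP[x0 x1]; have x1' : 0 < 1 - x by rewrite subr_gt0.
rewrite -[leRHS]mul1r ler_pdivlMr// mulrC -[1 - x]opprB mulNr -subrX1 opprB.
by rewrite gerBl exprn_ge0.
Qed.

Lemma cvg_inv_ln : ((ln n.+1%:R)^-1 : R) @[n --> \oo] --> (0 : R).
Proof.
apply/cvgrPdist_le => e e0; exists (Num.truncn (expR e^-1)) => // n /= nN.
have h : expR e^-1 <= n.+1%:R.
  by rewrite (le_trans (ltW (truncnS_gt _)))// ler_nat ltnS.
have l0 : e^-1 <= ln n.+1%:R by rewrite -ler_expR lnK// posrE.
have lp : 0 < ln n.+1%:R :> R by rewrite (lt_le_trans _ l0)// invr_gt0.
by rewrite sub0r normrN ger0_norm ?invr_ge0 ?(ltW lp)// invf_ple.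
Qed.

End real_sums.

Section asymptotics.
Context (R : realType) (F : probability (measurableTypeR R) R) (f : R -> R).
Hypothesis F_nneg : supported_nneg F.
Hypothesis F_variance : finite_variance F.
Hypothesis F_density : is_density F f.
Hypothesis f_cvg0 : f t @[t --> 0^'+] --> f 0.
Hypothesis f0_gt0 : 0 < f 0.

Definition sum_min_mean n : R := \sum_(k < n) fine (min_mean F k.+1).

(* [e] is at most [f 0 / 2], so that both [f 0 - e] and [f 0 + e] are positive;
   [dl] is shrunk so that [1 - (f 0 + e) * dl] is nonnegative. *)
Lemma tail_bounds_small (eta : R) : 0 < eta -> exists a b dl : R,
  [/\ 0 < a, 0 < b & 0 < dl] /\
  [/\ a^-1 <= (f 0)^-1 + eta, (f 0)^-1 - eta <= b^-1, a * dl <= 1, b * dl <= 1 &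
    forall t, 0 <= t <= dl -> 1 - b * t <= tail F t <= 1 - a * t].
Proof.
move=> eta0; have f0n0 : f 0 != 0 by rewrite gt_eqF.
(* As f(0) - e >= f(0) / 2, the error 1 / (f(0) - e) - 1 / f(0) is at most 2 e / f(0)^2, hence at
   most [eta]. *)
pose e := Num.min (f 0 / 2) (eta * f 0 ^+ 2 / 2).
have e0 : 0 < e by rewrite lt_min !divr_gt0// mulr_gt0// exprn_gt0.
have ef : e <= f 0 / 2 by rewrite ge_min lexx.
have ee : e <= eta * f 0 ^+ 2 / 2 by rewrite ge_min lexx orbT.
have [dl0 dl0_gt0 tb] := tail_bounds F_nneg F_density f_cvg0 e0.
have a0 : 0 < f 0 - e by lra.
have b0 : 0 < f 0 + e by lra.
exists (f 0 - e), (f 0 + e), (Num.min dl0 (f 0 + e)^-1).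
have bdl : (f 0 + e) * Num.min dl0 (f 0 + e)^-1 <= 1.
  by rewrite mulrC -ler_pdivlMr// mul1r ge_min lexx orbT.
have dlp : 0 < Num.min dl0 (f 0 + e)^-1 by rewrite lt_min dl0_gt0 invr_gt0.
split; first by split.
split => //.
- rewrite -div1r ler_pdivrMr// mulrDl mulrBr mulVf//.
  have : eta * e <= eta * (f 0 / 2) by rewrite ler_pM2l.
  have : (f 0)^-1 * e <= (f 0)^-1 * (eta * f 0 ^+ 2 / 2) by rewrite ler_pM2l// invr_gt0.
  have -> : (f 0)^-1 * (eta * f 0 ^+ 2 / 2) = eta * f 0 / 2 by field.
  lra.
- rewrite -[leRHS]div1r ler_pdivlMr// mulrBl mulrDr mulVf//.
  have : eta * e >= 0 by rewrite mulr_ge0// ltW.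
  have : (f 0)^-1 * e <= (f 0)^-1 * (eta * f 0 ^+ 2 / 2) by rewrite ler_pM2l// invr_gt0.
  have -> : (f 0)^-1 * (eta * f 0 ^+ 2 / 2) = eta * f 0 / 2 by field.
  have : eta * f 0 >= 0 by rewrite mulr_ge0// ltW.
  lra.
- apply: le_trans bdl; rewrite ler_pM2r//; lra.
- move=> t /andP[t0 tdl]; apply: tb; rewrite t0/= (le_trans tdl)//.
  by rewrite ge_min lexx.
Qed.

(** Each term is 1 / (f(0) (k+2)) up to a relative error governed by [eta] and a remainder geometric
    in [k]. The remainders sum to a constant, which depends on [eta] but not on [n] and disappears
    after division by log n. *)
Lemma sum_min_mean_bounds (eta : R) : 0 < eta -> exists C, forall n,
  `|sum_min_mean n - ln n.+1%:R / f 0| <= eta * ln n.+1%:R + C.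
Proof.
move=> /tail_bounds_small[a [b [dl [[a0 b0 dl0] [ha hb adl bdl tb]]]]].
pose rho := tail F dl; pose rho' := 1 - b * dl; pose m1 := fine (min_mean F 1).
have m10 : 0 <= m1 by apply: fine_ge0; exact: min_mean_ge0.
have dlI : 0 <= dl <= dl by rewrite lexx ltW.
have rho01 : 0 <= rho < 1.
  rewrite tail_ge0/=; have /andP[_ h] := tb _ dlI; apply: le_lt_trans h _.
  by rewrite ltrBlDr ltrDl mulr_gt0.
have rho'01 : 0 <= rho' < 1 by rewrite subr_ge0 bdl ltrBlDr ltrDl mulr_gt0.
have up n : sum_min_mean n <= a^-1 * ln n.+1%:R + m1 * (1 - rho)^-1.
  apply: (@le_trans _ _ (\sum_(k < n) (a^-1 * k.+2%:R^-1 + m1 * rho ^+ k))).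
    apply: ler_sum => k _; rewrite -lee_fin fineK ?min_mean_fin//.
    apply: le_trans (min_mean_le F_variance _ a0 dl0 adl _) _.
      by move=> t /tb /andP[].
    by rewrite lee_fin invfM (mulrC m1).
  rewrite big_split/= -!mulr_sumr lerD// ler_wpM2l ?invr_ge0 ?(ltW a0)//.
    exact: sum_inv_le_ln.
  exact: sum_geometric_le.
have low n : b^-1 * (ln n.+1%:R - ln 2) - b^-1 * (1 - rho')^-1 <= sum_min_mean n.
  apply: (@le_trans _ _ (\sum_(k < n) (b^-1 * k.+2%:R^-1 - b^-1 * rho' ^+ k))).
    rewrite sumrB -!mulr_sumr lerB// ler_wpM2l ?invr_ge0 ?(ltW b0)//.
      exact: sum_inv_ge_ln.
    exact: sum_geometric_le.
  apply: ler_sum => k _; rewrite -lee_fin fineK ?min_mean_fin//.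
  apply: le_trans (min_mean_ge _ b0 dl0 bdl _); last by move=> t /tb /andP[].
  rewrite lee_fin -/rho' invfM mulrBl mul1r lerB// mulrCA ler_pM2l ?invr_gt0//.
  have /andP[r0 r1] := rho'01.
  rewrite -[leRHS]mulr1 ler_pM ?exprn_ge0 ?invr_ge0//.
    by apply: ler_wiXn2l; [|exact: ltW|rewrite -addn2 leq_addr].
  by rewrite invf_le1// ler1n.
exists (m1 * (1 - rho)^-1 + b^-1 * ln 2 + b^-1 * (1 - rho')^-1) => n.
have l0 : 0 <= ln n.+1%:R :> R by rewrite ln_ge0// ler1n.
have h1 : a^-1 * ln n.+1%:R <= ln n.+1%:R / f 0 + eta * ln n.+1%:R.
  by rewrite [X in X + _]mulrC -mulrDl ler_wpM2r.
have h2 : ln n.+1%:R / f 0 - eta * ln n.+1%:R <= b^-1 * ln n.+1%:R.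
  by rewrite [X in X - _]mulrC -mulrBl ler_wpM2r.
have h3 := up n; have h4 := low n; rewrite mulrBr in h4.
have /andP[_ r1] := rho01; have /andP[_ r1'] := rho'01.
have c1 : 0 <= m1 * (1 - rho)^-1 by rewrite mulr_ge0// invr_ge0 subr_ge0 ltW.
have c2 : 0 <= b^-1 * (1 - rho')^-1.
  by rewrite mulr_ge0// invr_ge0 ?subr_ge0 ltW.
have c3 : 0 <= b^-1 * ln 2 by rewrite mulr_ge0 ?invr_ge0 ?(ltW b0)// ln_ge0// ler1n.
by rewrite ler_norml; apply/andP; split; lra.
Qed.

Lemma cvg_sum_min_mean :
  sum_min_mean n / ln n.+1%:R @[n --> \oo] --> (f 0)^-1.
Proof.
apply/cvgrPdist_le => e e0.
have e20 : 0 < e / 2 by rewrite divr_gt0.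
have [C HC] := sum_min_mean_bounds e20.
have := @cvg_inv_ln R => /cvgrPdist_le /(_ (e / 2 / (`|C| + 1))).
have C1 : 0 < `|C| + 1 by rewrite ltr_pwDr.
rewrite divr_gt0// => /(_ isT) [N _ hN].
exists N.+1 => // n /= nN; have n0 : (0 < n)%N by rewrite (leq_trans _ nN).
have lp : 0 < ln n.+1%:R :> R by rewrite ln_gt0// ltr1n.
have := hN n (ltnW nN); rewrite sub0r normrN ger0_norm ?invr_ge0 ?(ltW lp)// => h.
have -> : (f 0)^-1 - sum_min_mean n / ln n.+1%:R =
    - ((sum_min_mean n - ln n.+1%:R / f 0) / ln n.+1%:R).
  by field; rewrite !gt_eqF.
rewrite normrN normrM normfV (gtr0_norm lp) ler_pdivrMr//.
apply: le_trans (HC n) _.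
have : (ln n.+1%:R)^-1 * (`|C| + 1) <= e / 2 by rewrite -ler_pdivlMr.
rewrite mulrC -ler_pdivlMr ?invr_gt0// invrK => h2.
have := ler_norm C; lra.
Qed.

End asymptotics.

(** * Mean square convergence *)

Section Lfun2.
Context d (T : measurableType d) (R : realType) (P : probability T R).
Local Open Scope ereal_scope.

Lemma Lnorm2E (X : T -> R) :
  'N[P]_(2%:E) [(fun w => (X w)%:E)] = (\int[P]_w ((X w) ^+ 2)%:E) `^ 2^-1.
Proof.
rewrite unlock /Lnorm; congr (_ `^ _); apply: eq_integral => w _ /=.
by rewrite powR_mulrn// real_normK ?num_real.
Qed.

Lemma Lfun2_sqr (X : T -> R) : measurable_fun setT X ->
  \int[P]_w ((X w) ^+ 2)%:E < +oo -> X \in Lfun P 2%:E.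
Proof.
move=> mX Xoo; rewrite inE; apply/andP; split; rewrite inE//=.
by rewrite /finite_norm Lnorm2E poweR_lty.
Qed.

End Lfun2.

(** * Mean square deviation of the tour length *)

Section tour_moments.
Context (R : realType) (F : probability (measurableTypeR R) R)
  d (Omega : measurableType d) (P : probability Omega R) (n : nat).
Local Notation V := 'I_n.+1.
Variable L : V -> V -> {RV P >-> R}.
Hypothesis L_iid : iid_distances F L.
Hypothesis F_nneg : supported_nneg F.
Hypothesis F_variance : finite_variance F.
Hypothesis F_atomless : forall x : R, F [set x] = 0%E.
Variable v : Omega -> nat -> V.
Hypothesis v_NN : forall w, is_NN_tour (fun i j => L i j w) ord0 (v w).
Hypothesis n_gt0 : (0 < n)%N.
Variable T : {RV P >-> R}.
Hypothesis T_length : forall w, T w = tour_length (fun i j => L i j w) (v w).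

Local Notation step := (step L v).
Local Notation A := (sum_min_mean F n).
Local Notation sigma2 := (fine (second_moment F)).

Let S (w : Omega) : R := \sum_(i < n) step i.+1 w.

Let rng (i : 'I_n) : (0 < i.+1 <= n)%N. Proof. exact: ltn_ord. Qed.
Let rng1 (i : 'I_n) : (0 < i.+1 <= n.+1)%N. Proof. exact: (leqW (ltn_ord i)). Qed.

Let mstep (i : 'I_n) : measurable_fun setT (step i.+1).
Proof. exact: (measurable_step L_iid v_NN (rng1 i)). Qed.

Let mlast : measurable_fun setT (step n.+1).
Proof. exact: (@measurable_step _ _ _ _ _ _ _ L_iid _ v_NN n.+1 (leqnn n.+1)). Qed.

Let mS : measurable_fun setT S.
Proof. by apply: measurable_sum => i. Qed.

Let S_ge0 w : 0 <= S w.
Proof. by apply: sumr_ge0 => i _; exact: step_ge0. Qed.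

Lemma tour_ae : {ae P, forall w, T w = S w + step n.+1 w}.
Proof.
exists (~` generic L); split.
- by apply: measurableC; exact: measurable_generic.
- exact: (generic_null L_iid F_nneg F_atomless).
move=> w /= h gw; apply: h; rewrite T_length (tour_length_steps v_NN gw n_gt0).
by rewrite big_nat_recr//= big_add1 big_mkord.
Qed.

(** The mean of [step i.+1], which is made with [n - i] cities left; ordinals below [n] start at 0
    while steps start at 1. *)
Let M (i : nat) : R := fine (min_mean F (n - i)).

Let M_fin (i : 'I_n) : min_mean F (n - i) \is a fin_num.
Proof. by rewrite -(prednK (n := n - i)) ?subn_gt0//; exact: min_mean_fin. Qed.

Let M_ge0 i : 0 <= M i.
Proof. by apply: fine_ge0; exact: min_mean_ge0. Qed.

Let sumM : \sum_(i < n) M i = A.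
Proof. by rewrite /M (sum_subn_rev _ (fun k => fine (min_mean F k))). Qed.

Local Open Scope ereal_scope.

Let intS : \int[P]_w (S w)%:E = A%:E.
Proof.
under eq_integral do rewrite /S -sumEFin.
rewrite ge0_integral_sum//; last 2 first.
- by move=> i; apply/measurable_EFinP.
- by move=> i w _; rewrite lee_fin; exact: step_ge0.
rewrite -sumM -sumEFin; apply: eq_bigr => i _.
by rewrite (expectation_step L_iid F_nneg F_atomless v_NN (rng i)) subSS fineK.
Qed.

Variable dl : R.
Hypothesis dl_ge0 : (0 <= dl)%R.

Let sq (i : nat) : R := (dl * M i + tail F dl ^+ (n - i.+1) * sigma2)%R.

(** The diagonal terms receive an extra nonnegative [M i * M i], so that the bounds sum to exactly
    [A ^+ 2] plus the sum of the [sq i]. *)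
Let prod_le (i j : 'I_n) :
  \int[P]_w (step i.+1 w * step j.+1 w)%:E <= (M i * M j + (sq i *+ (i == j)))%:E.
Proof.
have ME (k : 'I_n) : min_mean F (n.+1 - k.+1) = (M k)%:E by rewrite subSS /M fineK.
have [ij|ij] := eqVneq i j.
  rewrite -ij mulr1n; under eq_integral do rewrite -expr2.
  apply: le_trans (expectation_step_sqr L_iid F_nneg F_atomless v_NN (rng i) dl_ge0) _.
  rewrite ME -[second_moment F]fineK ?second_moment_fin// -!EFinM -EFinD lee_fin.
  by rewrite /sq lerDr mulr_ge0.
rewrite mulr0n addr0.
wlog ji : i j ij / (j < i)%N.
  move=> H; have := ij; rewrite neq_ltn => /orP[lt|]; last exact: H.
  under eq_integral do rewrite mulrC.
  by rewrite mulrC; apply: H => //; rewrite eq_sym.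
under eq_integral do rewrite mulrC.
rewrite (expectation_step_prod L_iid F_nneg F_atomless v_NN
  (i := i.+1) (j := j.+1)) ?ltnS//.
by rewrite !ME -EFinM mulrC.
Qed.

Let intS2 : \int[P]_w (S w ^+ 2)%:E <= (A ^+ 2 + \sum_(i < n) sq i)%:E.
Proof.
under eq_integral do rewrite /S expr2 mulr_suml -sumEFin.
rewrite ge0_integral_sum//; last 2 first.
- by move=> i; apply/measurable_EFinP; apply: measurable_funM.
- move=> i w _; rewrite lee_fin mulr_ge0//; first exact: step_ge0.
  exact: S_ge0.
have -> : (A ^+ 2 + \sum_(i < n) sq i =
    \sum_(i < n) \sum_(j < n) (M i * M j + (sq i *+ (i == j))))%R.
  rewrite expr2 -sumM mulr_suml -big_split/=; apply: eq_bigr => i _.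
  rewrite big_split/= mulr_sumr; congr (_ + _)%R.
  by rewrite (bigD1 i)//= eqxx mulr1n big1 ?addr0// => j ji; rewrite eq_sym (negbTE ji).
rewrite -sumEFin; apply: lee_sum => i _.
under eq_integral do rewrite mulr_sumr -sumEFin.
rewrite ge0_integral_sum//; last 2 first.
- by move=> j; apply/measurable_EFinP; apply: measurable_funM.
- by move=> j w _; rewrite lee_fin mulr_ge0//; exact: step_ge0.
by rewrite -sumEFin; apply: lee_sum => j _; exact: prod_le.
Qed.

Hypothesis tail01 : (0 < tail F dl < 1)%R.

Let sum_sq : (\sum_(i < n) sq i <= dl * A + (1 - tail F dl)^-1 * sigma2)%R.
Proof.
rewrite /sq big_split/= -mulr_sumr sumM lerD2l -mulr_suml ler_wpM2r//.
  by apply: fine_ge0; apply: integral_ge0 => x _; rewrite lee_fin sqr_ge0.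
rewrite (reindex_inj rev_ord_inj)/=.
under eq_bigr => i _.
  have -> : (n - (n - i.+1).+1 = i)%N by rewrite subnSK// subKn// ltnW.
  over.
by apply: sum_geometric_le; case/andP: tail01 => q0 ->; rewrite ltW.
Qed.

Let s2_ge0 : (0 <= sigma2)%R.
Proof. by apply: fine_ge0; apply: integral_ge0 => x _; rewrite lee_fin sqr_ge0. Qed.

Let intS_centered (a : R) : (0 <= a)%R ->
  \int[P]_w ((S w - a) ^+ 2)%:E <=
    ((A - a) ^+ 2 + (dl * A + (1 - tail F dl)^-1 * sigma2))%:E.
Proof.
move=> a0.
have mS2 : measurable_fun setT (fun w => (S w ^+ 2)%:E).
  by apply/measurable_EFinP; exact: measurable_funX.
have mSa : measurable_fun setT (fun w => ((S w - a) ^+ 2)%:E).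
  by apply/measurable_EFinP; apply: measurable_funX; exact: measurable_funB.
(* Adding [2 * a * S] makes every integrand nonnegative, so that the integral is
   additive without integrability conditions. *)
have E : \int[P]_w ((S w - a) ^+ 2)%:E + (2 * a * A)%:E =
    \int[P]_w (S w ^+ 2)%:E + (a ^+ 2)%:E.
  have -> : (2 * a * A)%:E = \int[P]_w (2 * a * S w)%:E.
    under eq_integral do rewrite EFinM.
    rewrite ge0_integralZl//; last 3 first.
    - exact/measurable_EFinP.
    - by move=> w _; rewrite lee_fin S_ge0.
    - by rewrite lee_fin mulr_ge0.
    by rewrite intS EFinM.
  have -> : (a ^+ 2)%:E = \int[P]_w (cst (a ^+ 2)%:E w).
    by rewrite integral_cst//= probability_setT mule1.
  rewrite -!ge0_integralD//.
  - by apply: eq_integral => w _; rewrite -!EFinD; congr EFin; ring.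
  - by move=> w _; rewrite lee_fin sqr_ge0.
  - by move=> w _; rewrite lee_fin sqr_ge0.
  - by move=> w _; rewrite lee_fin sqr_ge0.
  - by move=> w _; rewrite lee_fin !mulr_ge0.
  - by apply/measurable_EFinP; exact: measurable_funM.
rewrite -(@leeD2rE _ (2 * a * A)%:E)// E.
apply: (@le_trans _ _ ((A ^+ 2 + \sum_(i < n) sq i)%:E + (a ^+ 2)%:E)).
  by rewrite leeD2rE.
rewrite -!EFinD lee_fin; have := sum_sq; lra.
Qed.

Lemma tour_Lfun2 : (T : Omega -> R) \in Lfun P 2%:E.
Proof.
apply: Lfun2_sqr => //.
apply: (@le_lt_trans _ _ (\int[P]_w
    (2%:E * (S w ^+ 2)%:E + 2%:E * (step n.+1 w ^+ 2)%:E))).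
  apply: ae_ge0_le_integral => //.
  - by move=> w _; rewrite lee_fin sqr_ge0.
  - by apply/measurable_EFinP; apply: measurable_funX.
  - by move=> w _; rewrite adde_ge0// mule_ge0// lee_fin sqr_ge0.
  - by apply: emeasurable_funD; apply: measurable_funeM; apply/measurable_EFinP;
      exact: measurable_funX.
  apply: filterS tour_ae => w -> _; rewrite -!EFinM -EFinD lee_fin.
  have := sqr_ge0 (S w - step n.+1 w); lra.
rewrite ge0_integralD//; last 4 first.
- by move=> w _; rewrite mule_ge0// lee_fin sqr_ge0.
- by apply: measurable_funeM; apply/measurable_EFinP; exact: measurable_funX.
- by move=> w _; rewrite mule_ge0// lee_fin sqr_ge0.
- by apply: measurable_funeM; apply/measurable_EFinP; exact: measurable_funX.
rewrite !ge0_integralZl//; last 4 first.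
- by apply/measurable_EFinP; exact: measurable_funX.
- by move=> w _; rewrite lee_fin sqr_ge0.
- by apply/measurable_EFinP; exact: measurable_funX.
- by move=> w _; rewrite lee_fin sqr_ge0.
have h2 := expectation_last_sqr_crude L_iid F_nneg F_atomless v_NN n_gt0.
rewrite -[second_moment F]fineK ?second_moment_fin// -EFinM in h2.
apply: le_lt_trans (leeD (lee_wpmul2l _ intS2) (lee_wpmul2l _ h2)) _ => //.
by rewrite -!EFinM -EFinD ltry.
Qed.

(** The closing edge depends on the other steps, so it is split off by (x + y)^2 <= 2 x^2 + 2 y^2.
    The centre [a] is left free because it will be log n / f(0) rather than the mean. *)
Lemma tour_centered (a : R) : (1 < n)%N -> (0 <= a)%R ->
  \int[P]_w ((T w - a) ^+ 2)%:E <=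
    (2 * ((A - a) ^+ 2 + dl * A +
      (2 * (1 - tail F dl)^-1 + (tail F dl)^-1) * sigma2))%:E.
Proof.
move=> n1 a0.
apply: (@le_trans _ _ (\int[P]_w
    (2%:E * ((S w - a) ^+ 2)%:E + 2%:E * (step n.+1 w ^+ 2)%:E))).
  apply: ae_ge0_le_integral => //.
  - by move=> w _; rewrite lee_fin sqr_ge0.
  - by apply/measurable_EFinP; apply: measurable_funX; apply: measurable_funB.
  - by move=> w _; rewrite adde_ge0// mule_ge0// lee_fin sqr_ge0.
  - apply: emeasurable_funD; apply: measurable_funeM; apply/measurable_EFinP;
      apply: measurable_funX => //; exact: measurable_funB.
  apply: filterS tour_ae => w -> _; rewrite -!EFinM -EFinD lee_fin.
  have := sqr_ge0 (S w - a - step n.+1 w); lra.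
rewrite ge0_integralD//; last 4 first.
- by move=> w _; rewrite mule_ge0// lee_fin sqr_ge0.
- apply: measurable_funeM; apply/measurable_EFinP;
    apply: measurable_funX => //; exact: measurable_funB.
- by move=> w _; rewrite mule_ge0// lee_fin sqr_ge0.
- by apply: measurable_funeM; apply/measurable_EFinP; exact: measurable_funX.
rewrite !ge0_integralZl//; last 4 first.
- by apply/measurable_EFinP; exact: measurable_funX.
- by move=> w _; rewrite lee_fin sqr_ge0.
- by apply/measurable_EFinP; apply: measurable_funX => //; exact: measurable_funB.
- by move=> w _; rewrite lee_fin sqr_ge0.
have /andP[q0 q1] := tail01.
have h1 := intS_centered a0.
have h2 := expectation_last_sqr L_iid F_nneg F_atomless v_NN n1 q0.
rewrite -[second_moment F]fineK ?second_moment_fin// -EFinM in h2.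
apply: le_trans (leeD (lee_wpmul2l _ h1) (lee_wpmul2l _ h2)) _ => //.
rewrite -!EFinM -EFinD lee_fin.
(* The bound on the closing edge, taken at [m = dl], becomes uniform in [n]: the left side is at
   most the geometric sum of its first [n] powers, each being at least the last. *)
have nq : (n%:R * tail F dl ^+ n.-1 <= (1 - tail F dl)^-1)%R.
  apply: le_trans (sum_geometric_le n _); last by rewrite q1 ltW.
  rewrite -[n in n%:R]card_ord -sumr_const mulr_suml; apply: ler_sum => k _.
  rewrite mul1r; apply: ler_wiXn2l; rewrite ?ltW//.
  by rewrite -ltnS prednK.
have := ler_wpM2r s2_ge0 nq; lra.
Qed.

End tour_moments.

(** * Consequences of a vanishing mean square bound *)

Section mean_square_convergence.
Context (R : realType) (d : nat -> measure_display)
  (Omega : forall n : nat, measurableType (d n))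
  (P : forall n : nat, probability (Omega n) R).
Variables (X : forall n : nat, Omega n -> R) (c : R) (u : R^nat).
Arguments X : clear implicits.
Hypothesis X_Lfun2 : forall n, X n \in Lfun (P n) 2%:E.
Hypothesis u_cvg0 : u @ \oo --> 0.
Local Open Scope ereal_scope.
Hypothesis X_le : \forall n \near \oo,
  \int[P n]_w ((X n w - c) ^+ 2)%:E <= (u n)%:E.

Let mX n : measurable_fun setT (X n).
Proof. by have := X_Lfun2 n; rewrite inE => /andP[]; rewrite inE. Qed.

Let mXc n : measurable_fun setT (fun w => ((X n w - c) ^+ 2)%R).
Proof. by apply: measurable_funX; exact: measurable_funB. Qed.

Lemma ms_cvg_in_probability : cvg_in_probability P X c.
Proof.
move=> e e0; have e20 : (0 < e ^+ 2)%R by rewrite exprn_gt0.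
apply: (@squeeze_cvge _ _ _ _ (cst 0) _ (fun n => (e ^- 2 * u n)%:E)).
- near=> n; rewrite measure_ge0/=.
  have mA : measurable [set w | (e < `|X n w - c|)%R].
    rewrite (_ : [set _ | _] = (fun w => X n w - c)%R @^-1` [set x : R | e < `|x|]%R)//.
    rewrite -[X in measurable X]setTI; apply: measurable_funB => //.
    exact: measurable_abs_gt.
  rewrite EFinM lee_pdivlMl//.
  have : \int[P n]_w ((X n w - c) ^+ 2)%:E <= (u n)%:E by near: n.
  apply: le_trans.
  rewrite -[P n _]mul1e -[1]/(1%:E).
  have -> : (e ^+ 2)%:E * (1 * P n [set w | (e < `|X n w - c|)%R]) =
    \int[P n]_(w in [set w | (e < `|X n w - c|)%R]) (e ^+ 2)%:E.
    by rewrite mul1e integral_cst.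
  apply: (@le_trans _ _
      (\int[P n]_(w in [set w | (e < `|X n w - c|)%R]) ((X n w - c) ^+ 2)%:E)).
    apply: ge0_le_integral => //.
    - by move=> w _; rewrite lee_fin ltW.
    - by apply: measurable_funTS; exact/measurable_EFinP.
    - move=> w /= ew; rewrite lee_fin -[X in (_ <= X)%R]real_normK ?num_real//.
      by rewrite lerXn2r ?nnegrE// ltW.
  apply: ge0_subset_integral => //.
  - exact/measurable_EFinP.
  - by move=> w _; rewrite lee_fin sqr_ge0.
- exact: cvg_cst.
- apply/cvg_EFin; first exact: nearW.
  rewrite -(mulr0 (e ^- 2)%R); apply: cvgM => //; exact: cvg_cst.
Unshelve. all: by end_near. Qed.

Lemma ms_cvg_in_L2 : cvg_in_Lp 2%:E P X c.
Proof.
split => //.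
apply: (@squeeze_cvge _ _ _ _ (cst 0) _ (fun n => (Num.sqrt (u n))%:E)).
- near=> n; rewrite Lnorm_ge0/=.
  have h : \int[P n]_w ((X n w - c) ^+ 2)%:E <= (u n)%:E by near: n.
  rewrite Lnorm2E poweR12_sqrt; last first.
    by apply: integral_ge0 => w _; rewrite lee_fin sqr_ge0.
  have i0 : 0 <= \int[P n]_w ((X n w - c) ^+ 2)%:E.
    by apply: integral_ge0 => w _; rewrite lee_fin sqr_ge0.
  have ifin : \int[P n]_w ((X n w - c) ^+ 2)%:E \is a fin_num.
    by rewrite ge0_fin_numE// (le_lt_trans h) ?ltry.
  move: h i0; rewrite -(fineK ifin) !lee_fin /= => h i0.
  exact: ler_wsqrtr.
- exact: cvg_cst.
- apply/cvg_EFin; first exact: nearW.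
  rewrite -[X in _ --> X]sqrtr0.
  exact: (continuous_cvg _ (@sqrt_continuous R 0%R) u_cvg0).
Unshelve. all: by end_near. Qed.

Lemma ms_cvg_expectation : 'E_(P n)[X n] @[n --> \oo] --> c%:E.
Proof.
have X1 n : X n \in Lfun (P n) 1.
  by apply: Lfun_subset12; [exact: fin_num_measure|exact: X_Lfun2].
apply/fine_cvgP; split; first by apply: nearW => n; exact: expectation_fin_num.
apply/subr_cvg0/norm_cvg0P.
apply: (@squeeze_cvgr _ _ _ _ (cst 0%R) (fun n => Num.sqrt (u n))).
- near=> n; rewrite normr_ge0/=.
  have h : \int[P n]_w ((X n w - c) ^+ 2)%:E <= (u n)%:E by near: n.
  pose Y := (X n \- cst c)%R.
  have Y2 : Y \in Lfun (P n) 2%:E by rewrite rpredB//= ?lee1n// Lfun_cst.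
  have EY : 'E_(P n)[Y] = 'E_(P n)[X n] - c%:E.
    by rewrite expectationB ?Lfun_cst// expectation_cst.
  (* Nonnegativity of the variance of [Y] is the inequality (E X - c)^2 <= E (X - c)^2. *)
  have := variance_ge0 (P n) Y; rewrite varianceE// EY sube_ge0; last first.
    by rewrite fin_numX// fin_numB expectation_fin_num.
  rewrite -[X in X - _]fineK ?expectation_fin_num// -EFinB -EFin_expe => h'.
  have : ((fine 'E_(P n)[X n] - c) ^+ 2 <= u n)%R.
    rewrite -lee_fin; apply: le_trans h; apply: le_trans h' _.
    by rewrite unlock; apply: le_refl.
  by move=> /ler_wsqrtr; rewrite sqrtr_sqr.
- exact: cvg_cst.
- rewrite -[X in _ --> X]sqrtr0.
  exact: (continuous_cvg _ (@sqrt_continuous R 0%R) u_cvg0).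
Unshelve. all: by end_near. Qed.

End mean_square_convergence.

(* The [n]-th problem has [n.+1] cities, so that there is always a first city
   [ord0]; [T n] is the paper's T^NN_{n+1}. *)
Theorem theorem2p2 (R : realType)
    (F : probability (measurableTypeR R) R) (f : R -> R)
    (F_nneg : supported_nneg F)
    (F_mean : finite_mean F) (F_variance : finite_variance F)
    (F_density : is_density F f)
    (f_cvg0 : f t @[t --> 0^'+] --> f 0) (f0_gt0 : 0 < f 0)
    (d : nat -> measure_display)
    (Omega : forall n : nat, measurableType (d n))
    (P : forall n : nat, probability (Omega n) R)
    (L : forall n : nat,
       'I_n.+1 -> 'I_n.+1 -> {RV (P n) >-> R})
    (L_iid : forall n : nat, iid_distances F (@L n))
    (v : forall n : nat, Omega n -> nat -> 'I_n.+1)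
    (v_NN : forall (n : nat) (w : Omega n),
       is_NN_tour (fun i j => L n i j w) ord0 (v n w))
    (T : forall n : nat, {RV (P n) >-> R})
    (T_length : forall (n : nat) (w : Omega n),
       T n w = tour_length (fun i j => L n i j w) (v n w)) :
  [/\ cvg_in_probability P (fun n w => T n w / ln n.+1%:R) (f 0)^-1,
      ('E_(P n) [T n] * (((f 0)^-1 * ln n.+1%:R)^-1)%:E @[n --> \oo] --> 1)%E &
      cvg_in_Lp 2%:E P (fun n w => T n w / ln n.+1%:R) (f 0)^-1].
Proof.
have F_atomless := density_atomless F_density.
have c0 : 0 < (f 0)^-1 by rewrite invr_gt0.
set c := (f 0)^-1 in c0 *.
have [a [b [dl' [[a0 b0 dl0'] [_ _ _ bdl tb]]]]] :=
  tail_bounds_small F_nneg F_density f_cvg0 f0_gt0 ltr01.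
(* At [dl'] the lower bound [1 - b * dl'] of the tail may vanish; at half of it the bound is at
   least 1/2. *)
pose dl := dl' / 2; have dl0 : 0 < dl by rewrite divr_gt0.
have tail01 : 0 < tail F dl < 1.
  have /andP[h1 h2] : 1 - b * dl <= tail F dl <= 1 - a * dl.
    by apply: tb; rewrite ltW//= ler_pdivrMr// ler_peMr ?ler1n// ltW.
  apply/andP; split.
    apply: lt_le_trans h1; rewrite subr_gt0 /dl mulrA.
    apply: le_lt_trans (_ : 1 / 2 < 1); first by rewrite ler_pM2r.
    by rewrite ltr_pdivrMr// mul1r ltr1n.
  by apply: le_lt_trans h2 _; rewrite ltrBlDr ltrDl mulr_gt0.
pose K := (2 * (1 - tail F dl)^-1 + (tail F dl)^-1) * fine (second_moment F).
pose lN n : R := ln n.+1%:R.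
pose A n : R := sum_min_mean F n.
(* The bound of [tour_centered] at the centre [c * lN n], divided by [lN n ^+ 2]. *)
pose u n := 2 * ((A n / lN n - c) ^+ 2 +
  dl * (A n / lN n) * (lN n)^-1 + K * (lN n)^-1 ^+ 2).
pose X n (w : Omega n) := T n w / lN n.
have lN_gt0 n : (0 < n)%N -> 0 < lN n by move=> n0; rewrite ln_gt0// ltr1n.
have XL n : X n \in Lfun (P n) 2%:E.
  case: n => [|n].
    (* With one city the normalization is ln 1 = 0, and division by zero makes [X 0] the null
       function. *)
    rewrite (_ : X 0%N = cst 0); first exact: Lfun_cst.
    by apply/funext => w; rewrite /X /lN ln1 invr0 mulr0.
  have TL := tour_Lfun2 (L_iid n.+1) F_nneg F_variance F_atomless
    (v_NN n.+1) isT (T_length n.+1).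
  (* Square integrability needs no decay of the tail, so the truncation level 0 is enough. *)
  by apply: (@Lfun_scale _ _ _ _ _ (lN n.+1)^-1) (TL 0 (lexx _)); rewrite ler1n.
have u_cvg0 : u @ \oo --> 0.
  have cA : (fun n => A n / lN n) @ \oo --> c by exact: cvg_sum_min_mean.
  have cl : (fun n => (lN n)^-1) @ \oo --> (0 : R) by exact: cvg_inv_ln.
  rewrite (_ : 0 = 2 * ((c - c) * (c - c) + dl * c * 0 + K * (0 * 0))); last by ring.
  apply: cvgM; first exact: cvg_cst.
  apply: cvgD; first apply: cvgD.
  - rewrite (_ : (fun x => _) =
        (fun n => (A n / lN n - c) * (A n / lN n - c))); last first.
      by apply/funext => n; rewrite expr2.
    by apply: cvgM; apply: cvgB => //; exact: cvg_cst.
  - by apply: cvgM => //; apply: cvgM => //; exact: cvg_cst.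
  - apply: cvgM; first exact: cvg_cst.
    rewrite (_ : (fun x => _) = (fun n => (lN n)^-1 * (lN n)^-1)); last first.
      by apply/funext => n; rewrite expr2.
    by apply: cvgM.
have X_le : \forall n \near \oo, (\int[P n]_w ((X n w - c) ^+ 2)%:E <= (u n)%:E)%E.
  near=> n; have n1 : (1 < n)%N by near: n; exists 2%N.
  have n0 : (0 < n)%N by exact: ltnW.
  have lp := lN_gt0 n n0.
  have cl0 : 0 <= c * lN n by rewrite mulr_ge0 ?ltW.
  have h := tour_centered (L_iid n) F_nneg F_variance F_atomless (v_NN n) n0
    (T_length n) (ltW dl0) tail01 n1 cl0.
  rewrite (_ : \int[_]_w _ = ((lN n)^-1 ^+ 2)%:E *
      \int[P n]_w ((T n w - c * lN n) ^+ 2)%:E)%E; last first.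
    rewrite -ge0_integralZl//.
    - by apply: eq_integral => w _; rewrite -EFinM /X; congr EFin; field; rewrite gt_eqF.
    - by apply/measurable_EFinP; apply: measurable_funX; exact: measurable_funB.
    - by move=> w _; rewrite lee_fin sqr_ge0.
    - by rewrite lee_fin sqr_ge0.
  apply: (le_trans (lee_wpmul2l _ h)); first by rewrite lee_fin sqr_ge0.
  rewrite -EFinM lee_fin -/(A n) -/K /u le_eqVlt; apply/orP; left; apply/eqP.
  by field; rewrite gt_eqF.
split.
- exact: (ms_cvg_in_probability XL u_cvg0 X_le).
- have EX := ms_cvg_expectation XL u_cvg0 X_le.
  have : ('E_(P n)[X n] * (c^-1)%:E @[n --> \oo] --> c%:E * (c^-1)%:E)%E.
    by apply: cvgeM => //; exact: cvg_cst.
  rewrite -EFinM divff ?gt_eqF//; apply: cvg_trans; apply: near_eq_cvg.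
  near=> n; have n0 : (0 < n)%N by near: n; exists 1%N.
  have lp := lN_gt0 n n0.
  have TL := tour_Lfun2 (L_iid n) F_nneg F_variance F_atomless (v_NN n) n0
    (T_length n) (lexx 0).
  have T1 : (T n : Omega n -> R) \in Lfun (P n) 1.
    by apply: Lfun_subset12 TL; exact: fin_num_measure.
  rewrite (_ : X n = ((lN n)^-1 \o* T n)); last by apply/funext.
  rewrite expectationZl// [(_%:E * 'E_(P n)[_])%E]muleC -muleA -EFinM -invfM.
  by rewrite (mulrC _ c).
- exact: (ms_cvg_in_L2 XL u_cvg0 X_le).
Unshelve. all: by end_near. Qed.
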